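(* Let $X_j$, $j\in\mathbb N$, be zero-mean random processes on $[0,1]$ with continuous covariance functions satisfying the Basic assumption, let $Y_d$, $d\in\mathbb N$, be the associated additive random fields, and let $n^{Y_d}(\varepsilon)$ be their average case approximation complexity. For $d\in\mathbb N$ let $\varepsilon_d\in[0,1]$ be defined by $$\varepsilon_d^2=\frac{\sum_{j=1}^d\bar\Lambda^{X_j}}{\sum_{j=1}^d\Lambda^{X_j}},$$ and (when $\varepsilon_d>0$) let $F_d$ be the distribution function $$F_d(x)=\frac{\sum_{j=1}^d\sum_{k=1}^\infty \bar\lambda^{X_j}_k\,\mathbf 1\bigl(\bar\lambda^{X_j}_k\geqslant e^{-x}\bigr)}{\sum_{j=1}^d\bar\Lambda^{X_j}},\qquad x\in\mathbb R.$$ Then for every $d\in\mathbb N$ such that $\varepsilon_d>0$ and for every $\varepsilon\in(0,\varepsilon_d)$, setting $$N_d(\varepsilon)=\Biggl\lceil \sum_{j=1}^d\bar\Lambda^{X_j}\cdot\int_0^{1-(\varepsilon/\varepsilon_d)^2}\exp\bigl\{F_d^{-1}(y)\bigr\}\,dy\Biggr\rceil,$$ one has $$N_d(\varepsilon)\leqslant n^{Y_d}(\varepsilon)\leqslant N_d(\varepsilon)+1 .$$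
   Context: $\mathbb N=\{1,2,\dots\}$. $\mathbf 1(A)$ equals $1$ if the proposition $A$ is true and $0$ otherwise; $\lceil\cdot\rceil$ is the ceiling function. For a distribution function $F$ on $\mathbb R$, $F^{-1}(y)=\inf\{x\in\mathbb R: F(x)\geqslant y\}$, $y\in(0,1)$. Setting. $X_j(t)$, $t\in[0,1]$, $j\in\mathbb N$, are zero-mean random processes with continuous covariance functions $\mathcal K^{X_j}(t,s)$. For each $d\in\mathbb N$, $Y_d(t)$, $t\in[0,1]^d$, is a zero-mean random field (a random element of $L_2([0,1]^d)$) with covariance function $\mathcal K^{Y_d}(t,s)=\sum_{j=1}^d\mathcal K^{X_j}(t_j,s_j)$, where $t=(t_1,\dots,t_d)$, $s=(s_1,\dots,s_d)$. Approximation complexity. Let $(\cdot,\cdot)_{2,d}$, $\|\cdot\|_{2,d}$ be the inner product and norm of $L_2([0,1]^d)$. For $n\in\mathbb N$ let $\mathcal A_n^{Y_d}=\{\sum_{m=1}^n (Y_d,\psi_m)_{2,d}\,\psi_m:\ \psi_m\in L_2([0,1]^d)\}$ and $e^{Y_d}(n)=\inf\{(\mathbb E\|Y_d-\widetilde Y\|_{2,d}^2)^{1/2}:\ \widetilde Y\in\mathcal A_n^{Y_d}\}$; let $e^{Y_d}(0)=(\mathbb E\|Y_d\|_{2,d}^2)^{1/2}<\infty$. For $\varepsilon\in(0,1)$, $n^{Y_d}(\varepsilon)=\min\{n\in\mathbb N:\ e^{Y_d}(n)\leqslant\varepsilon\, e^{Y_d}(0)\}$. Eigenvalues. $K^{X_j}$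 is the covariance operator on $L_2([0,1])$, i.e. the integral operator with kernel $\mathcal K^{X_j}$; $(\lambda_k^{X_j})_{k\in\mathbb N}$ is its non-increasing sequence of eigenvalues (counted with multiplicity) with corresponding orthonormal eigenvectors $\psi_k^{X_j}$; if $K^{X_j}$ has finite rank $p$, one sets $\lambda_k^{X_j}=0$, $\psi_k^{X_j}\equiv0$ for $k>p$. $\Lambda^{X_j}=\sum_{k=1}^\infty\lambda_k^{X_j}$ is the trace. Basic assumption: for every $j\in\mathbb N$ the function identically equal to $1$ on $[0,1]$ is one of the eigenvectors $\psi_k^{X_j}$, $k\in\mathbb N$. Let $\bar\lambda_0^{X_j}$ be the eigenvalue corresponding to this eigenvector $1$, let $(\bar\lambda_k^{X_j})_{k\in\mathbb N}$ be the non-increasing sequence of the remaining eigenvalues, and $\bar\Lambda^{X_j}=\sum_{k\in\mathbb N}\bar\lambda_k^{X_j}=\Lambda^{X_j}-\bar\lambda_0^{X_j}$. *)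

(* Defs.v *)
From HB Require Import structures.
From mathcomp Require Import all_boot all_order all_algebra.
From mathcomp Require Import all_classical all_reals all_analysis.

Set Implicit Arguments.
Unset Strict Implicit.
Unset Printing Implicit Defensive.
Import Order.TTheory GRing.Theory Num.Theory.
Import numFieldNormedType.Exports.

Local Open Scope classical_set_scope.
Local Open Scope ring_scope.

(* Conventions. All indices are 0-based: the objects written X_j, lambda_k,
   psi_k with j, k in {1, 2, ...} are X j.-1, lam k.-1, psi k.-1 below.
   Functions on [0, 1] or on [0, 1]^d are represented by functions on R or on
   d-tuples of reals, whose values outside the cube play no role; elements of
   L_2 are represented by members of Lfun. *)

Section lebesgue_on_cubes.
Variable R : realType.

Definition leb01 : set (measurableTypeR R) -> \bar R :=
  mrestr lebesgue_measure (measurable_itv `[(0 : R), 1]).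

HB.instance Definition _ := Measure.on leb01.

Let leb01_setT : leb01 setT = 1%:E.
Proof.
by rewrite /leb01 /mrestr setTI lebesgue_measure_itv/= lte_fin ltr01 oppr0 adde0.
Qed.

HB.instance Definition _ :=
  Measure_isProbability.Build _ _ R leb01 leb01_setT.

Definition cons_pair d (x : measurableTypeR R * d.-tuple (measurableTypeR R)) :
    d.+1.-tuple (measurableTypeR R) :=
  [tuple of x.1 :: x.2].

Let measurable_cons_pair d : measurable_fun setT (@cons_pair d).
Proof. exact: measurable_cons. Qed.

HB.instance Definition _ d :=
  isMeasurableFun.Build _ _ _ _ (@cons_pair d) (@measurable_cons_pair d).

(* d-dimensional Lebesgue measure on the cube [0, 1]^d, as the d-fold product
   of leb01 transported to d-tuples. *)
Fixpoint leb_cube d : probability (d.-tuple (measurableTypeR R)) R :=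
  match d with
  | 0 => [the probability _ R of \d_([tuple] : 0.-tuple (measurableTypeR R))]
  | d'.+1 => [the probability _ R of
      distribution [the probability _ R of (leb01 \x leb_cube d')%E]
                   [the {mfun _ >-> _} of @cons_pair d']]
  end.

Definition cube d : set (d.-tuple R) :=
  [set t | forall i, tnth t i \in `[0, 1]].

Lemma leb_cube_box d (A : 'I_d -> set (measurableTypeR R)) :
  (forall i, measurable (A i)) ->
  leb_cube d [set t | forall i, A i (tnth t i)] =
  (\prod_(i < d) leb01 (A i))%E.
Proof.
elim: d A => [|d IHd] A mA.
  rewrite big_ord0 /= (_ : [set _ | _] = setT) ?diracT//.
  by apply/seteqP; split => // t _ [].
rewrite big_ord_recl -IHd//= /distribution /pushforward.
rewrite (_ : _ @^-1` _ = A ord0 `*` [set t | forall i, A (lift ord0 i) (tnth t i)]).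
  rewrite product_measure1E//.
  rewrite (_ : [set _ | _] = \bigcap_(i in [set: 'I_d])
      ((fun t : d.-tuple (measurableTypeR R) => tnth t i) @^-1` A (lift ord0 i))).
    apply: fin_bigcap_measurable => // i _; rewrite -[_ @^-1` _]setTI.
    exact: measurable_tnth.
  by apply/seteqP; split => [t At i _|t At i]; exact: At.
apply/seteqP; split => [[x t] /= At|[x t] /= [A0 At] i].
  split; first exact: (At ord0).
  by move=> i; have := At (lift ord0 i); rewrite /cons_pair/= tnthS.
case: (unliftP ord0 i) => [k ->|->//].
by rewrite /cons_pair/= tnthS.
Qed.

End lebesgue_on_cubes.

Definition inner d (T : measurableType d) (R : realType)
    (mu : {measure set T -> \bar R}) (D : set T) (f g : T -> R) : R :=
  \int[mu]_(x in D) (f x * g x).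

Section random_fields.
Context d (Omega : measurableType d) (R : realType) (P : probability Omega R).

Definition cov (I : Type) (X : I -> Omega -> R) (t s : I) : R :=
  fine (covariance P (X t) (X s)).

Definition zero_mean_field (I : Type) (D : set I) (X : I -> Omega -> R) :=
  forall t, D t -> X t \in Lfun P 2%:E /\ ('E_P[X t] = 0)%E.

Definition continuous_covariance (X : R -> Omega -> R) :=
  {within `[0, 1]%classic `*` `[0, 1]%classic,
    continuous (fun ts : R * R => cov X ts.1 ts.2)}.

(* Y is a random element of L_2([0, 1]^n): joint measurability makes
   w |-> Y ^~ w a random element of L_2 whose pairings with L_2 functions are
   compatible with the pointwise field; its paths are almost surely square
   integrable as soon as the covariance is integrable on the diagonal. *)
Definition additive_field (X : nat -> R -> Omega -> R) n
    (Y : n.-tuple (measurableTypeR R) -> Omega -> R) :=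
  [/\ measurable_fun (@cube R n `*` [set: Omega]) (fun tw => Y tw.1 tw.2),
      zero_mean_field (@cube R n) Y &
      forall t s, cube t -> cube s ->
        cov Y t s = \sum_(j < n) cov (X j) (tnth t j) (tnth s j)].

Section approximation.
Variable n : nat.
Implicit Type Y : n.-tuple (measurableTypeR R) -> Omega -> R.

(* (E ||Y||_{2,n}^2)^{1/2} *)
Definition rms_norm Y : \bar R :=
  sqrte (\int[P]_w \int[leb_cube R n]_(t in @cube R n) (Y t w ^+ 2)%:E)%E.

Definition rank_approx m (psi : 'I_m -> n.-tuple (measurableTypeR R) -> R) Y :
    n.-tuple (measurableTypeR R) -> Omega -> R :=
  fun t w =>
    \sum_(i < m) inner (leb_cube R n) (@cube R n) (Y ^~ w) (psi i) * psi i t.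

(* The psi_i range over all of L_2; they are not required to be orthonormal. *)
Definition approx_error Y m : \bar R :=
  ereal_inf [set rms_norm (fun t w => Y t w - rank_approx psi Y t w) |
    psi in [set psi : 'I_m -> n.-tuple (measurableTypeR R) -> R |
              forall i, psi i \in Lfun (leb_cube R n) 2%:E]].

Definition is_complexity Y (eps : R) (m : nat) :=
  let ok k := (0 < k)%N /\ (approx_error Y k <= eps%:E * rms_norm Y)%E in
  ok m /\ forall k, ok k -> (m <= k)%N.

End approximation.
End random_fields.

Section spectrum.
Variable R : realType.
Implicit Types (K : R -> R -> R) (f : R -> R) (lam : nat -> R).
Local Notation mu := (@lebesgue_measure R).

Definition integral_operator K f : R -> R :=
  fun t => \int[mu]_(s in `[0, 1]) (K t s * f s).

(* (lam, psi) lists the nonzero eigenvalues of a nonnegative integral operator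
   in non-increasing order with multiplicity, along with orthonormal
   eigenvectors; both sequences are padded by 0 if the rank is finite. The last
   clause says that the list is exhaustive and accounts for multiplicities:
   every eigenvector for a nonzero eigenvalue a is a linear combination of the
   psi_k with lam k = a. *)
Record eigensystem K lam (psi : nat -> R -> R) : Prop := Eigensystem {
  eigen_L2 : forall k, psi k \in Lfun (@leb01 R) 2%:E ;
  eigen_ge0 : forall k, 0 <= lam k ;
  eigen_noninc : nonincreasing_seq lam ;
  eigen_pad : forall k, lam k = 0 -> ae_eq mu `[0, 1]%classic (psi k) (cst 0) ;
  eigen_orthonormal : forall k l, lam k != 0 -> lam l != 0 ->
    inner mu `[0, 1]%classic (psi k) (psi l) = (k == l)%:R ;
  eigen_eq : forall k,
    ae_eq mu `[0, 1]%classic (integral_operator K (psi k)) (fun t => lam k * psi k t) ;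
  eigen_exhaustive : forall (a : R) f, a != 0 -> f \in Lfun (@leb01 R) 2%:E ->
    ae_eq mu `[0, 1]%classic (integral_operator K f) (fun t => a * f t) ->
    exists n (c : nat -> R), ae_eq mu `[0, 1]%classic f
      (fun t => \sum_(k < n | lam k == a) c k * psi k t) }.

Definition total lam : R := limn (series lam).

(* What remains of lam once its entry of index k0 has been removed. *)
Definition remaining lam (k0 : nat) : nat -> R := fun k => lam (bump k0 k).

End spectrum.

Section bounds.
Variable R : realType.

Definition quantile (F : R -> R) (y : R) : R := inf [set x | y <= F x].

(* lam j and blam j stand for the eigenvalues of the j-th covariance operator
   and for the same sequence without the eigenvalue of the constant 1. *)
Variables lam blam : nat -> nat -> R.

Definition eps_crit d : R :=
  Num.sqrt ((\sum_(j < d) total (blam j)) / \sum_(j < d) total (lam j)).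

Definition spectral_cdf d (x : R) : R :=
  (\sum_(j < d) total (fun k => blam j k * (expR (- x) <= blam j k)%R%:R)) /
  \sum_(j < d) total (blam j).

Definition complexity_bound d (eps : R) : int :=
  Num.ceil ((\sum_(j < d) total (blam j)) *
    \int[lebesgue_measure]_(y in `]0, (1 - (eps / eps_crit d) ^+ 2)[)
      expR (quantile (spectral_cdf d) y)).

End bounds.

(* Main.v *)
From HB Require Import structures.
Require Import Defs.
From mathcomp Require Import all_boot all_order all_algebra.
From mathcomp Require Import all_classical all_reals all_analysis measurable_realfun.
From mathcomp Require Import ring lra.
Import Order.TTheory GRing.Theory Num.Theory.
Import numFieldNormedType.Exports.
Local Open Scope classical_set_scope.
Local Open Scope ring_scope.

Set Implicit Arguments.
Unset Strict Implicit.
Unset Printing Implicit Defensive.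

(** The whole question takes place in the spectrum of the covariance operator
of Y_d. Write S for the sum of the barred traces, L for the sum of all traces,
and q = (eps / eps_d)^2, so that q S = eps^2 L.

Spectrum. The kernel of Y_d is a sum of kernels of the separate coordinates.
A function psi(t_j) of one coordinate that is orthogonal to 1 has mean 0, hence
is killed by the kernels of the other coordinates, which are independent of
t_j. Since 1 is an eigenfunction in each coordinate, the barred eigenfunctions
psi^j_k(t_j) are eigenfunctions of Y_d with the eigenvalues bar-lambda^j_k, and
the constant 1 is one for the sum mu_0 of the bar-lambda^j_0 ([eigen_one],
[eigen_coord]); all of them are orthonormal. They exhaust the spectrum because
E ||Y_d||^2, the integral of the kernel on the diagonal, equals
L = mu_0 + S ([trace_total]). One inequality is Bessel's. The other one is
needed for one process on [0, 1] ([trace_le_total]) and has a Mercer-type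
proof: after the first N eigenvectors are removed, the form of the covariance
operator is bounded by lam N ([deflated_form_le]), since the top of the form of
a nonnegative operator close to finite rank is an eigenvalue, obtained by power
iteration ([top_eigenvector]). On an orthonormal family of n normalized cells
of a partition, which computes the trace up to a small error, the residual
then costs at most n lam N, which tends to 0 with N.

Errors. Projecting on 1 and on the barred eigenfunctions of the k largest
barred eigenvalues leaves an error of S minus the sum M_k of these eigenvalues
([error_eigen], [approx_error_le]). Conversely, n arbitrary directions cannot
see some projection of corank at most n in the space of coefficients of the
barred eigenfunctions; measuring the error there gives, for each threshold c >=
0, an error of at least the sum of the min(b, c) over the barred eigenvalues b,
minus c n ([error_ge_threshold]). With c the barred eigenvalue of rank k and n
< k this is at least S - M_(k-1). The lower bound simply forgets the constant
direction, which is the reason for the gap of one in the theorem.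

The integral. Let m be least with M_m >= (1 - q) S. The two bounds say that an
admissible number of terms is at least m, and that m + 1 terms suffice. On the
interval where M_(k-1) < y S <= M_k, the quantile of F_d at y is minus the
logarithm of the barred eigenvalue mu_k of rank k ([quantile_ranked]). The
exponential of the quantile is thus 1 / mu_k on an interval of length mu_k / S:
S times the integral counts 1 for each full interval and, for the last one, cut
at y = 1 - q, a fraction in (0, 1] ([integral_quantile]). Its ceiling is m. *)

(** * Complements on limits and integrals *)

Lemma cvg_sumR (R : realType) (I : Type) (r : seq I) (F : I -> nat -> R) (a : I -> R) :
  (forall i, F i n @[n --> \oo] --> a i) ->
  \sum_(i <- r) F i n @[n --> \oo] --> \sum_(i <- r) a i.
Proof.
move=> Fa; elim: r => [|i r IH].
  by under eq_fun do rewrite big_nil; rewrite big_nil; exact: cvg_cst.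
by under eq_fun do rewrite big_cons; rewrite big_cons; exact: cvgD.
Qed.

Lemma ae_eq_Rintegral d (T : measurableType d) (R : realType)
    (mu : {measure set T -> \bar R}) (f g : T -> R) :
  measurable_fun setT f -> measurable_fun setT g -> {ae mu, forall x, f x = g x} ->
  \int[mu]_x f x = \int[mu]_x g x.
Proof.
move=> mf mg fg; congr fine; apply: ae_eq_integral => //.
- exact/measurable_EFinP.
- exact/measurable_EFinP.
by apply: filterS fg => x -> _.
Qed.

Section full_measure.
Context d (T : measurableType d) (R : realType) (mu : {measure set T -> \bar R}).
Variable D : set T.
Hypotheses (mD : measurable D) (D_full : mu (~` D) = 0%E).

Lemma ae_full (P : T -> Prop) : (forall x, D x -> P x) -> {ae mu, forall x, P x}.
Proof.
move=> DP; exists (~` D); split => //; first exact: measurableC.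
by apply: subsetC => x; exact: DP.
Qed.

Lemma integral_full (f : T -> \bar R) : measurable_fun setT f ->
  (\int[mu]_(x in D) f x = \int[mu]_x f x)%E.
Proof.
move=> mf; rewrite integral_mkcond; apply: ae_eq_integral => //.
  by apply/measurable_restrict => //; rewrite ?setIT; exact: measurable_funTS.
by apply: ae_full => x Dx _; rewrite patchE mem_set.
Qed.

Lemma Rintegral_full (f : T -> R) : measurable_fun setT f ->
  \int[mu]_(x in D) f x = \int[mu]_x f x.
Proof. by move=> mf; rewrite /Rintegral integral_full//; exact/measurable_EFinP. Qed.

End full_measure.

Section fubini.
Context d1 d2 (T1 : measurableType d1) (T2 : measurableType d2) (R : realType).
Variables (m1 : probability T1 R) (m2 : probability T2 R).
Implicit Type F : T1 * T2 -> R.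

Lemma integrable_tensor (a : T1 -> R) (b : T2 -> R) :
  m1.-integrable setT (EFin \o a) -> m2.-integrable setT (EFin \o b) ->
  (m1 \x m2)%E.-integrable setT (EFin \o (fun p => a p.1 * b p.2)).
Proof.
move=> ia ib.
have ma := (measurable_EFinP setT a).1 (measurable_int _ ia).
have mb := (measurable_EFinP setT b).1 (measurable_int _ ib).
have mab : measurable_fun setT (fun p : T1 * T2 => a p.1 * b p.2).
  apply: measurable_funM.
  - exact: (measurableT_comp ma measurable_fst).
  - exact: (measurableT_comp mb measurable_snd).
apply/integrable12ltyP; first exact/measurable_EFinP.
rewrite (eq_integral (fun x => `|a x|%:E * \int[m2]_y `|b y|%:E)%E); last first.
  move=> x _; rewrite -ge0_integralZl//.
  - by apply: eq_integral => y _; rewrite /= normrM.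
  - exact/measurable_EFinP/measurableT_comp.
have /integrableP[_ iae] := ia; have /integrableP[_ ibe] := ib.
rewrite ge0_integralZr//; first by rewrite lte_mul_pinfty// ?integral_ge0// ge0_fin_numE// integral_ge0.
- exact/measurable_EFinP/measurableT_comp.
- by apply: integral_ge0.
Qed.

Variable F : T1 * T2 -> R.
Hypothesis iF : (m1 \x m2)%E.-integrable setT (EFin \o F).

Lemma measurable_Rintegral1 : measurable_fun setT (fun x => \int[m2]_y F (x, y)).
Proof.
apply: (measurableT_comp (fine_measurable measurableT)).
exact: (measurable_fubini_F iF).
Qed.

Lemma measurable_Rintegral2 : measurable_fun setT (fun y => \int[m1]_x F (x, y)).
Proof.
apply: (measurableT_comp (fine_measurable measurableT)).
exact: (measurable_fubini_G iF).
Qed.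

(** The extended integral of almost every section is finite, so that taking its
    real part loses nothing. *)
Lemma ae_Rintegral1 : ae_eq m1 setT
  (fun x => (\int[m2]_y F (x, y))%:E) (fun x => (\int[m2]_y (F (x, y))%:E)%E).
Proof.
apply: filterS (ae_integrable1 iF) => x ix _.
by rewrite fineK//; exact: (integrable_fin_num measurableT ix).
Qed.

Lemma ae_Rintegral2 : ae_eq m2 setT
  (fun y => (\int[m1]_x F (x, y))%:E) (fun y => (\int[m1]_x (F (x, y))%:E)%E).
Proof.
apply: filterS (ae_integrable2 iF) => x ix _.
by rewrite fineK//; exact: (integrable_fin_num measurableT ix).
Qed.

Lemma Rintegral_prod1 :
  \int[m1]_x (\int[m2]_y F (x, y)) = \int[(m1 \x m2)%E]_p F p.
Proof.
congr fine; rewrite -(integral12_prod_meas1 iF); apply: ae_eq_integral => //.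
- exact/measurable_EFinP/measurable_Rintegral1.
- exact: (measurable_fubini_F iF).
- exact: ae_Rintegral1.
Qed.

Lemma Rintegral_prod2 :
  \int[m2]_y (\int[m1]_x F (x, y)) = \int[(m1 \x m2)%E]_p F p.
Proof.
congr fine; rewrite -(integral21_prod_meas1 iF); apply: ae_eq_integral => //.
- exact/measurable_EFinP/measurable_Rintegral2.
- exact: (measurable_fubini_G iF).
- exact: ae_Rintegral2.
Qed.

Lemma Rfubini :
  \int[m1]_x (\int[m2]_y F (x, y)) = \int[m2]_y (\int[m1]_x F (x, y)).
Proof. by rewrite Rintegral_prod1 Rintegral_prod2. Qed.

Lemma integrable_Rintegral2 :
  m2.-integrable setT (EFin \o (fun y => \int[m1]_x F (x, y))).
Proof.
have mF := measurable_int _ iF.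
apply/integrableP; split; first exact/measurable_EFinP/measurable_Rintegral2.
have := (integrable21ltyP m1 m2 mF).1 iF; apply: le_lt_trans.
apply: ge0_le_integral => //=.
- apply/measurable_EFinP; apply: measurableT_comp => //; exact: measurable_Rintegral2.
- apply: (measurable_fun_fubini_tonelli_G (abse \o (EFin \o F))) => //=.
  exact: measurableT_comp.
move=> y _; apply: (@le_trans _ _ `|\int[m1]_x (F (x, y))%:E|%E).
  by rewrite /Rintegral; case: (\int[m1]_x _)%E => [r| |] //=; rewrite normr0 leey.
by apply: le_abse_integral => //; exact: (measurableT_comp mF (pair2_measurable y)).
Qed.

End fubini.

Section measure_preserving.
Context d d' (T : measurableType d) (T' : measurableType d') (R : realType).
Variables (mu : {measure set T -> \bar R}) (nu : {measure set T' -> \bar R}).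
Variable phi : T -> T'.
Hypothesis mphi : measurable_fun setT phi.
Hypothesis phi_law : forall A, measurable A -> mu (phi @^-1` A) = nu A.

HB.instance Definition _ := isMeasurableFun.Build _ _ _ _ phi mphi.

Lemma ge0_integral_law (f : T' -> \bar R) : measurable_fun setT f ->
  (forall x, 0 <= f x)%E -> (\int[mu]_t f (phi t) = \int[nu]_x f x)%E.
Proof.
move=> mf f0.
have := ge0_integral_pushforward mphi mu measurableT mf (fun x _ => f0 x).
rewrite preimage_setT => <-; apply: eq_measure_integral => A mA _.
by rewrite -phi_law.
Qed.

Lemma integrable_law (f : T' -> \bar R) : nu.-integrable setT f ->
  mu.-integrable setT (f \o phi).
Proof.
move=> /integrableP[mf fi]; apply/integrableP; split.
  exact: measurableT_comp mf mphi.
have -> : (\int[mu]_x `|(f \o phi) x| = \int[nu]_x `|f x|)%E; last by [].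
apply: (ge0_integral_law (f := abse \o f)) => [|x]; last exact: abse_ge0.
apply: measurableT_comp => //; exact: mf.
Qed.

Lemma Rintegral_law (f : T' -> R) : nu.-integrable setT (EFin \o f) ->
  \int[mu]_t f (phi t) = \int[nu]_x f x.
Proof.
move=> fi; congr fine.
have := integral_pushforward mphi (measurable_int _ fi) (integrable_law fi) measurableT.
rewrite preimage_setT => <-; apply: eq_measure_integral => A mA _.
by rewrite -phi_law.
Qed.

Lemma ae_law (Q : T' -> Prop) : {ae nu, forall x, Q x} -> {ae mu, forall t, Q (phi t)}.
Proof.
move=> [N [mN N0 H]]; exists (phi @^-1` N); split.
- by rewrite -[_ @^-1` _]setTI; exact: mphi.
- by rewrite phi_law.
- by move=> t /= nQ; exact: H.
Qed.

End measure_preserving.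

Section product_law.
Context d d1 d2 (T : measurableType d) (T1 : measurableType d1)
  (T2 : measurableType d2) (R : realType).
Variables (mu : probability T R) (nu1 : probability T1 R) (nu2 : probability T2 R).
Variable phi : T -> T1 * T2.
Hypothesis mphi : measurable_fun setT phi.
Hypothesis box_law : forall A B, measurable A -> measurable B ->
  mu (phi @^-1` (A `*` B)) = (nu1 A * nu2 B)%E.

HB.instance Definition _ := isMeasurableFun.Build _ _ _ _ phi mphi.

Lemma product_law A : measurable A -> mu (phi @^-1` A) = (nu1 \x nu2)%E A.
Proof.
move=> mA; have := @product_measure_unique _ _ T1 T2 R nu1 nu2 (pushforward mu phi).
by move=> /(_ mphi box_law A mA) ->.
Qed.

End product_law.

(** * Semi-inner product spaces *)

(** Positivity is not assumed strict, so that functions equal almost everywhere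
    need not be identified; a vector counts as zero when its norm vanishes. *)
Record semi_inner (R : realType) (V : lmodType R) (ip : V -> V -> R) : Prop :=
  SemiInner {
  ipC : forall f g, ip f g = ip g f ;
  ipDl : forall f g h, ip (f + g) h = ip f h + ip g h ;
  ipZl : forall a f g, ip (a *: f) g = a * ip f g ;
  ip_ge0 : forall f, 0 <= ip f f }.

Section semi_inner_theory.
Variables (R : realType) (V : lmodType R) (ip : V -> V -> R).
Hypothesis ipP : semi_inner ip.
Implicit Types f g h : V.

Definition nrm f := Num.sqrt (ip f f).

Lemma ip0l f : ip 0 f = 0.
Proof. by rewrite -(scale0r 0) (ipZl ipP) mul0r. Qed.

Lemma ip0r f : ip f 0 = 0. Proof. by rewrite (ipC ipP) ip0l. Qed.

Lemma ipDr f g h : ip f (g + h) = ip f g + ip f h.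
Proof. by rewrite (ipC ipP) (ipDl ipP) !(ipC ipP f). Qed.

Lemma ipZr a f g : ip f (a *: g) = a * ip f g.
Proof. by rewrite (ipC ipP) (ipZl ipP) (ipC ipP f). Qed.

Lemma ipNl f g : ip (- f) g = - ip f g.
Proof. by rewrite -scaleN1r (ipZl ipP) mulN1r. Qed.

Lemma ipNr f g : ip f (- g) = - ip f g.
Proof. by rewrite (ipC ipP) ipNl (ipC ipP f). Qed.

Lemma ipBl f g h : ip (f - g) h = ip f h - ip g h.
Proof. by rewrite (ipDl ipP) ipNl. Qed.

Lemma ipBr f g h : ip f (g - h) = ip f g - ip f h.
Proof. by rewrite ipDr ipNr. Qed.

Lemma ip_suml (I : Type) (r : seq I) (P : pred I) (F : I -> V) g :
  ip (\sum_(i <- r | P i) F i) g = \sum_(i <- r | P i) ip (F i) g.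
Proof.
elim/big_rec2: _ => [|i x y _ <-]; first exact: ip0l.
by rewrite (ipDl ipP).
Qed.

Lemma ip_sumr (I : Type) (r : seq I) (P : pred I) (F : I -> V) g :
  ip g (\sum_(i <- r | P i) F i) = \sum_(i <- r | P i) ip g (F i).
Proof. by rewrite (ipC ipP) ip_suml; apply: eq_bigr => i _; rewrite (ipC ipP). Qed.

Lemma ip_CS f g : ip f g ^+ 2 <= ip f f * ip g g.
Proof.
have Hg := ip_ge0 ipP g; have Hf := ip_ge0 ipP f.
have H a b : 0 <= a ^+ 2 * ip f f - 2 * a * b * ip f g + b ^+ 2 * ip g g.
  have := ip_ge0 ipP (a *: f - b *: g).
  rewrite ipBl !ipBr !(ipZl ipP) !ipZr (ipC ipP g f) => /le_trans; apply.
  by rewrite le_eqVlt; apply/orP; left; apply/eqP; ring.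
have [g0|g0] := eqVneq (ip g g) 0.
  have [->|fg0] := eqVneq (ip f g) 0; first by rewrite expr0n/= mulr_ge0.
  have := H 1 ((ip f f + 1) / ip f g / 2).
  rewrite g0 mulr0 addr0 expr1n mul1r mulr1.
  rewrite (_ : 2 * _ * _ = ip f f + 1); last by field.
  by move=> ?; exfalso; lra.
have {}g0 : 0 < ip g g by rewrite lt_neqAle eq_sym g0.
have := H (ip g g) (ip f g).
rewrite (_ : _ + _ = ip g g * (ip f f * ip g g - ip f g ^+ 2)); last by ring.
by rewrite pmulr_rge0// subr_ge0.
Qed.

Lemma nrm_ge0 f : 0 <= nrm f. Proof. exact: sqrtr_ge0. Qed.

Lemma nrm_sqr f : nrm f ^+ 2 = ip f f.
Proof. by rewrite sqr_sqrtr// (ip_ge0 ipP). Qed.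

Lemma nrm_le1 f : ip f f <= 1 -> nrm f <= 1.
Proof. by move=> f1; rewrite -ler_sqr ?nnegrE ?nrm_ge0// nrm_sqr expr1n. Qed.

Lemma nrm0 : nrm 0 = 0. Proof. by rewrite /nrm ip0l sqrtr0. Qed.

Lemma ip_le_nrm f g : `|ip f g| <= nrm f * nrm g.
Proof.
rewrite -ler_sqr ?nnegrE ?mulr_ge0 ?nrm_ge0// exprMn !nrm_sqr real_normK ?num_real//.
exact: ip_CS.
Qed.

Lemma nrmD f g : nrm (f + g) <= nrm f + nrm g.
Proof.
rewrite -ler_sqr ?nnegrE ?addr_ge0 ?nrm_ge0// sqrrD !nrm_sqr (ipDl ipP) !ipDr.
have := ip_le_nrm f g; rewrite ler_norml => /andP[_ H].
rewrite (ipC ipP g f); lra.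
Qed.

Lemma nrmZ a f : nrm (a *: f) = `|a| * nrm f.
Proof.
by rewrite /nrm (ipZl ipP) ipZr mulrA -expr2 sqrtrM ?sqr_ge0// sqrtr_sqr.
Qed.

Lemma nrmN f : nrm (- f) = nrm f.
Proof. by rewrite -scaleN1r nrmZ normrN1 mul1r. Qed.

Lemma nrm_dist f g : nrm (f - g) = nrm (g - f).
Proof. by rewrite -nrmN opprB. Qed.

Lemma nrmB f g : nrm f - nrm g <= nrm (f - g).
Proof. by rewrite lerBlDr -{1}(subrK g f) nrmD. Qed.

Lemma nrm_sum (I : Type) (r : seq I) (P : pred I) (F : I -> V) :
  nrm (\sum_(i <- r | P i) F i) <= \sum_(i <- r | P i) nrm (F i).
Proof.
elim/big_rec2: _ => [|i x y _ H]; first by rewrite nrm0.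
by apply: le_trans (nrmD _ _) _; rewrite lerD2l.
Qed.

Section residual.
Variables (I : finType) (P : pred I) (e : I -> V).
Hypothesis eO : forall i j, P i -> P j -> ip (e i) (e j) = (i == j)%:R.

Definition residual f := f - \sum_(i | P i) ip f (e i) *: e i.

Lemma ip_residual_l f g :
  ip (residual f) g = ip f g - \sum_(i | P i) ip f (e i) * ip g (e i).
Proof.
rewrite ipBl ip_suml; congr (_ - _); apply: eq_bigr => i _.
by rewrite (ipZl ipP) (ipC ipP (e i)).
Qed.

Lemma residual_ortho f i : P i -> ip (residual f) (e i) = 0.
Proof.
move=> Pi; rewrite ip_residual_l (bigD1 i)//= eO// eqxx mulr1 big1 ?addr0 ?subrr//.
by move=> j /andP[Pj ji]; rewrite eO// eq_sym (negbTE ji) mulr0.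
Qed.

Lemma residual_sym f g : ip (residual f) g = ip f (residual g).
Proof.
rewrite (ipC ipP f) !ip_residual_l (ipC ipP f); congr (_ - _).
by apply: eq_bigr => i _; rewrite mulrC.
Qed.

Lemma ip_residual f g :
  ip (residual f) (residual g) = ip f g - \sum_(i | P i) ip f (e i) * ip g (e i).
Proof.
rewrite [residual g]/residual ipBr ip_sumr big1 ?subr0 ?ip_residual_l// => i Pi.
by rewrite ipZr residual_ortho// mulr0.
Qed.

Lemma bessel f : \sum_(i | P i) ip f (e i) ^+ 2 <= ip f f.
Proof. by have := ip_ge0 ipP (residual f); rewrite ip_residual subr_ge0. Qed.

Lemma nrm_residual f : nrm (residual f) <= nrm f.
Proof.
rewrite ler_wsqrtr// ip_residual gerBl sumr_ge0// => i _.
by rewrite -expr2 sqr_ge0.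
Qed.

Lemma residual_linear : linear residual.
Proof.
move=> a f g; rewrite /residual scalerBr scaler_sumr addrACA -opprD -big_split/=.
congr (_ - _); apply: eq_bigr => i _.
by rewrite (ipDl ipP) (ipZl ipP) scalerDl scalerA.
Qed.

End residual.
End semi_inner_theory.

(** * The top of the spectrum by power iteration *)

Section top_eigenvector.
Variables (R : realType) (V : lmodType R) (ip : V -> V -> R).
Hypothesis ipP : semi_inner ip.
Local Notation nrm := (nrm ip).

Definition cauchy_nrm (f : nat -> V) :=
  forall e : R, 0 < e -> exists N, forall m n, (N <= m)%N -> (N <= n)%N ->
    nrm (f m - f n) <= e.

(** Closeness to finite rank in operator norm: a form of compactness that is
    checked directly on step kernels. *)
Definition finite_rank_approx (A : V -> V) := forall e : R, 0 < e ->
  exists n (u v : 'I_n -> V), forall f,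
    nrm (A f - \sum_i ip (u i) f *: v i) <= e * nrm f.

(** Power iteration takes limits of images under A only; completeness is asked
    of these images, where it is elementary for a bounded kernel. *)
Definition completing (A : V -> V) := forall f, cauchy_nrm f ->
  exists g, nrm (A (f n) - g) @[n --> \oo] --> (0 : R).

Definition psd_operator (A : V -> V) :=
  [/\ linear A, forall f g, ip (A f) g = ip f (A g) & forall f, 0 <= ip (A f) f].

Section linear_facts.
Variable A : V -> V.
Hypothesis Alin : linear A.

Lemma lin0 : A 0 = 0.
Proof. by have := Alin (-1) 0 0; rewrite scaler0 addr0 scaleN1r addNr. Qed.

Lemma linD f g : A (f + g) = A f + A g.
Proof. by have := Alin 1 f g; rewrite !scale1r. Qed.

Lemma linZ a f : A (a *: f) = a *: A f.
Proof. by have := Alin a f 0; rewrite lin0 !addr0. Qed.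

Lemma linB f g : A (f - g) = A f - A g.
Proof. by rewrite linD -scaleN1r linZ scaleN1r. Qed.

Lemma lin_sum (I : Type) (r : seq I) (F : I -> V) :
  A (\sum_(i <- r) F i) = \sum_(i <- r) A (F i).
Proof.
elim/big_rec2: _ => [|i x y _ <-]; first exact: lin0.
by rewrite linD.
Qed.

End linear_facts.

Section powers.
Variable S : V -> V.
Hypotheses (S_psd : psd_operator S) (S_le : forall f, ip (S f) f <= ip f f).

Let Slin : linear S. Proof. by case: S_psd. Qed.
Let Ssym f g : ip (S f) g = ip f (S g). Proof. by case: S_psd. Qed.
Let Spos f : 0 <= ip (S f) f. Proof. by case: S_psd. Qed.
Local Notation pow k f := (iter k S f).

Lemma linear_pow k : linear (fun f => pow k f).
Proof. by elim: k => [|k IH] a f g //=; rewrite IH Slin. Qed.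

Lemma ip_pow m n f : ip (pow m f) (pow n f) = ip (pow (m + n) f) f.
Proof. by elim: n m => [|n IHn] m; rewrite ?addn0// addnS -addSn -IHn /= Ssym. Qed.

Let S_inner : semi_inner (fun f g => ip (S f) g).
Proof.
split=> [f g|f g h|a f g|f] /=.
- by rewrite Ssym (ipC ipP).
- by rewrite linD// (ipDl ipP).
- by rewrite linZ// (ipZl ipP).
- exact: Spos.
Qed.

(** Cauchy-Schwarz for the semi-inner product (S f, g) with g = S f, together
    with the bound S <= 1 applied to S f. *)
Lemma ip_sqr_le f : ip (S f) (S f) <= ip (S f) f.
Proof.
have /= := ip_CS S_inner f (S f) => H.
have {}H : ip (S f) (S f) ^+ 2 <= ip (S f) f * ip (S f) (S f).
  by apply: le_trans H _; rewrite ler_wpM2l.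
have [->|n0] := eqVneq (ip (S f) (S f)) 0; first exact: Spos.
have n1 : 0 < ip (S f) (S f) by rewrite lt_neqAle eq_sym n0 (ip_ge0 ipP).
by move: H; rewrite expr2 ler_pM2r.
Qed.

Lemma nrm_contract f : nrm (S f) <= nrm f.
Proof. by rewrite ler_wsqrtr// (le_trans (ip_sqr_le f)). Qed.

Lemma nrm_pow k f : nrm (pow k f) <= nrm f.
Proof. by elim: k => //= k IH; exact: le_trans (nrm_contract _) IH. Qed.

Definition moment f k := ip (pow k f) f.

Lemma moment_double k f : moment f (k + k) = ip (pow k f) (pow k f).
Proof. by rewrite ip_pow. Qed.

(** An odd moment is a value of the form of S, an even one a squared norm. *)
Lemma moment_ge0 f k : 0 <= moment f k.
Proof.
rewrite -[k]odd_double_half -addnn; case: (odd k) => /=.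
  rewrite [leRHS](_ : _ = ip (S (pow k./2 f)) (pow k./2 f)); first exact: Spos.
  by rewrite -[S _]/(pow k./2.+1 f) ip_pow.
by rewrite add0n moment_double (ip_ge0 ipP).
Qed.

(** From odd to even order this is S^2 <= S, from even to odd it is S <= 1. *)
Lemma moment_noninc f : nonincreasing_seq (moment f).
Proof.
apply/nonincreasing_seqP => k.
rewrite -[k]odd_double_half -addnn; case: (odd k) => /=.
  rewrite add1n -addSn -addnS moment_double.
  rewrite [leRHS](_ : _ = ip (S (pow k./2 f)) (pow k./2 f)); first exact: ip_sqr_le.
  by rewrite -[S _]/(pow k./2.+1 f) ip_pow.
rewrite add0n moment_double [leLHS](_ : _ = ip (S (pow k./2 f)) (pow k./2 f)) ?S_le//.
by rewrite -[S _]/(pow k./2.+1 f) ip_pow.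
Qed.

Lemma cvg_moment f : cvgn (moment f).
Proof.
apply: nonincreasing_is_cvgn; first exact: moment_noninc.
by exists 0 => _ [k _ <-]; exact: moment_ge0.
Qed.

Lemma ip_pow_diff f m n :
  ip (pow m f - pow n f) (pow m f - pow n f) =
  moment f (m + m) - 2 * moment f (m + n) + moment f (n + n).
Proof.
rewrite (ipBl ipP) !(ipBr ipP) !ip_pow (addnC n m) /moment; ring.
Qed.

(** Since the moments decrease to a limit, the squared distance between two
    late powers, a second difference of moments, is small. *)
Lemma cauchy_pow f : cauchy_nrm (fun k => pow k f).
Proof.
move=> e e0; have [L ML] : exists L : R, moment f @ \oo --> L.
  by exists (limn (moment f)); exact: cvg_moment.
have e4 : 0 < e ^+ 2 / 4 by rewrite divr_gt0// exprn_gt0.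
move/cvgrPdist_le : ML => /(_ _ e4)[N _ HN]; exists N => m n Nm Nn.
rewrite -ler_sqr ?nnegrE ?nrm_ge0 ?(ltW e0)// nrm_sqr// ip_pow_diff.
have H1 := HN (m + m)%N (leq_trans Nm (leq_addl _ _)).
have H2 := HN (m + n)%N (leq_trans Nm (leq_addr _ _)).
have H3 := HN (n + n)%N (leq_trans Nn (leq_addl _ _)).
move: H1 H2 H3; rewrite !ler_norml => /andP[? ?] /andP[? ?] /andP[? ?]; lra.
Qed.

(** On the unit ball the square of the moment of order n is at most the moment
    of order 2n, by Cauchy-Schwarz; this is iterated from order 1. *)
Lemma moment_lower f t k : ip f f <= 1 -> 0 <= t -> t <= ip (S f) f ->
  t ^+ (2 ^ k) <= moment f (2 ^ k).
Proof.
move=> f1 t0 tf; elim: k => [|k IH]; first by rewrite expn0 expr1.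
rewrite expnS mul2n -addnn moment_double exprD -expr2.
apply: le_trans (_ : moment f (2 ^ k) ^+ 2 <= _).
  by rewrite ler_sqr ?nnegrE ?exprn_ge0 ?moment_ge0.
apply: le_trans (ip_CS ipP _ _) _; by rewrite ler_piMr// (ip_ge0 ipP).
Qed.

End powers.

Lemma psd_scale A a : 0 <= a -> psd_operator A -> psd_operator (fun f => a *: A f).
Proof.
move=> a0 [Alin Asym Apos]; split=> [b f g|f g|f].
- by rewrite Alin scalerDr !scalerA mulrC.
- by rewrite (ipZl ipP) (ipZr ipP) Asym.
- by rewrite (ipZl ipP) mulr_ge0.
Qed.

Lemma nrm_eq0_ip f g : nrm f = 0 -> ip f g = 0.
Proof.
move=> f0; apply/eqP; rewrite -normr_le0.
by apply: le_trans (ip_le_nrm ipP f g) _; rewrite f0 mul0r.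
Qed.

Section attained.
Variables (A : V -> V) (rho : R).
Hypotheses (A_psd : psd_operator A) (A_fr : finite_rank_approx A).
Hypotheses (A_compl : completing A) (rho_gt0 : 0 < rho).
Hypothesis A_le : forall f, ip (A f) f <= rho * ip f f.
Hypothesis A_sup : forall t, t < rho -> exists f, ip f f <= 1 /\ t < ip (A f) f.

Let S f := rho^-1 *: A f.
Local Notation pow k f := (iter k S f).

Let S_psd : psd_operator S.
Proof. by apply: psd_scale => //; rewrite invr_ge0 ltW. Qed.

Let S_le f : ip (S f) f <= ip f f.
Proof. by rewrite (ipZl ipP) ler_pdivrMl. Qed.

Let AS f : A f = rho *: S f.
Proof. by rewrite /S scalerA divff ?scale1r// gt_eqF. Qed.

Let Alin : linear A. Proof. by case: A_psd. Qed.

(** If all the powers of S died out pointwise, they would do so uniformly on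
    the image of the unit ball by A, which is nearly finite dimensional. But
    vectors on which the form of S is close to 1 have powers that stay large,
    by [moment_lower]. *)
Lemma some_pow_survives : exists f, limn (moment S f) != 0.
Proof.
apply: contrapT => no.
have lim0 f : nrm (pow n f) @[n --> \oo] --> 0.
  apply/cvgrPdist_le => e e0.
  have m0 : moment S f @ \oo --> 0.
    have := @cvg_moment _ S_psd S_le f.
    by case: (eqVneq (limn (moment S f)) 0) => [<-//|n0]; case: no; exists f.
  have e2 : 0 < e ^+ 2 by rewrite exprn_gt0.
  move/cvgrPdist_le : m0 => /(_ _ e2)[N _ HN]; exists N => // n /= Nn.
  rewrite sub0r normrN ger0_norm ?nrm_ge0//.
  rewrite -ler_sqr ?nnegrE ?nrm_ge0 ?(ltW e0)// nrm_sqr// -moment_double//.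
  have := HN (n + n)%N (leq_trans Nn (leq_addl _ _)).
  rewrite sub0r normrN; apply: le_trans; exact: ler_norm.
(* Two tolerances of rho / 8 keep the powers below rho / 4 on the image of the
   unit ball, half of what a form close enough to rho forces. *)
have [n [u [v Huv]]] := A_fr (divr_gt0 rho_gt0 (ltr0Sn R 7)).
have [m Hm] : exists m, forall f, ip f f <= 1 -> nrm (pow m (A f)) <= rho / 4.
  have : \sum_(i < n) (nrm (u i) * nrm (pow m (v i))) @[m --> \oo] --> 0.
    rewrite [X in _ --> X](_ : _ = \sum_(i < n) (nrm (u i) * 0)).
      apply: cvg_sumR => i; apply: cvgMl_tmp; exact: lim0.
    by rewrite big1// => i _; rewrite mulr0.
  have r8 : 0 < rho / 8 by rewrite divr_gt0.
  move/cvgrPdist_le => /(_ _ r8)[m _] /(_ m (leqnn _)); rewrite sub0r normrN => /(le_trans (ler_norm _)) Hm.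
  exists m => f f1.
  have nf := nrm_le1 ipP f1.
  rewrite -[A f](subrK (\sum_i ip (u i) f *: v i)).
  rewrite (linD (linear_pow S_psd m)) (lin_sum (linear_pow S_psd m)).
  apply: le_trans (nrmD ipP _ _) _.
  rewrite (_ : rho / 4 = rho / 8 + rho / 8); last by field.
  apply: lerD.
    apply: le_trans (nrm_pow S_psd S_le _ _) _; apply: le_trans (Huv f) _.
    by rewrite ler_piMr// divr_ge0// ltW.
  apply: le_trans (nrm_sum ipP _ _ _) _; apply: le_trans Hm.
  apply: ler_sum => i _; rewrite (linZ (linear_pow S_psd m)) nrmZ//.
  rewrite ler_wpM2r ?nrm_ge0//; apply: le_trans (ip_le_nrm ipP _ _) _.
  by rewrite ler_piMr// nrm_ge0.
pose k := (2 ^ m)%N; have k0 : 0 < k%:R :> R by rewrite ltr0n expn_gt0.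
have k1 : 1 <= k%:R :> R by rewrite ler1n expn_gt0.
(* Bernoulli: (1 - 1 / 2k) ^ k >= 1 / 2 *)
pose t : R := 1 - (2 * k%:R)^-1.
have ti : (2 * k%:R)^-1 <= 2^-1 :> R by rewrite lef_pV2 ?posrE ?mulr_gt0// ler_peMr.
have t0 : 0 <= t by rewrite /t; lra.
have tk : 2^-1 <= t ^+ k.
  have B j : 1 - j%:R * (2 * k%:R)^-1 <= t ^+ j.
    elim: j => [|j IH]; first by rewrite mul0r subr0 expr0.
    rewrite exprS; apply: le_trans (_ : t * (1 - j%:R * (2 * k%:R)^-1) <= _).
      rewrite /t -natr1 -subr_ge0.
      rewrite (_ : _ - _ = j%:R * (2 * k%:R)^-1 ^+ 2); last by ring.
      by rewrite mulr_ge0// sqr_ge0.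
    by rewrite ler_wpM2l.
  apply: le_trans (B k); rewrite invfM mulrCA divff ?gt_eqF//; lra.
have [f [f1 ft]] : exists f, ip f f <= 1 /\ rho * t < ip (A f) f.
  by apply: A_sup; rewrite gtr_pMr// /t gtrBl invr_gt0 mulr_gt0.
have Sf : t <= ip (S f) f.
  by rewrite (ipZl ipP) ler_pdivlMl// ltW.
have H1 := moment_lower S_psd m f1 t0 Sf.
have H2 : moment S f (2 ^ m) <= moment S f m.+1.
  by apply: moment_noninc => //; rewrite ltn_expl.
have H3 : moment S f m.+1 <= nrm (pow m.+1 f).
  apply: le_trans (ler_norm _) _; apply: le_trans (ip_le_nrm ipP _ _) _.
  by rewrite ler_piMr ?nrm_ge0 ?nrm_le1.
have H4 : nrm (pow m.+1 f) = rho^-1 * nrm (pow m (A f)).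
  rewrite iterSr {2}/S (linZ (linear_pow S_psd m)) nrmZ//.
  by rewrite gtr0_norm ?invr_gt0.
have H5 : rho^-1 * nrm (pow m (A f)) <= 4^-1.
  by rewrite ler_pdivrMl//; exact: Hm.
have := le_trans tk (le_trans H1 (le_trans H2 H3)).
by rewrite H4; lra.
Qed.

(** The surviving orbit is Cauchy, hence its image by A converges; as the orbit
    moves less and less under S, the limit is fixed by S, and it is nonzero
    because the norms of the orbit stay above a positive bound. *)
Lemma top_eigenvector : exists g, 0 < nrm g /\ nrm (A g - rho *: g) = 0.
Proof.
have [f Lf] := some_pow_survives; set L := limn _ in Lf.
have mL : moment S f @ \oo --> L by exact: cvg_moment.
have [g Hg] := A_compl (cauchy_pow S_psd S_le f); exists g.
have L0 : 0 < L.
  rewrite lt_neqAle eq_sym Lf/=; apply: limr_ge; first exact: cvg_moment.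
  by apply: nearW => k; exact: moment_ge0.
have geL n : L <= nrm (pow n f) ^+ 2.
  rewrite nrm_sqr// -moment_double//.
  apply: nonincreasing_cvgn_ge; [exact: moment_noninc|exact: cvg_moment].
have Hg' : nrm (rho *: pow n.+1 f - g) @[n --> \oo] --> 0.
  by under eq_fun do rewrite iterS -AS.
split.
  have r2 : 0 < rho * Num.sqrt L / 2 by rewrite divr_gt0// mulr_gt0// sqrtr_gt0.
  have /cvgrPdist_le := Hg'; move=> /(_ _ r2)[N _] /(_ N (leqnn _)); rewrite sub0r normrN ger0_norm ?nrm_ge0// => HN.
  have : rho * Num.sqrt L <= nrm (rho *: pow N.+1 f).
    rewrite nrmZ// gtr0_norm// ler_pM2l// -[leRHS]ger0_norm ?nrm_ge0//.
    by rewrite -sqrtr_sqr ler_wsqrtr.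
  have := nrmB ipP (rho *: pow N.+1 f) g.
  have : 0 < rho * Num.sqrt L by rewrite mulr_gt0// sqrtr_gt0.
  lra.
apply/eqP; rewrite eq_le nrm_ge0 andbT.
apply/ler_addgt0Pl => e e0; rewrite addr0.
have e2 : 0 < e / (2 * rho) by rewrite divr_gt0// mulr_gt0.
have /cvgrPdist_le := Hg'; move=> /(_ _ e2)[N1 _ HN1].
have [N2 HN2] := cauchy_pow S_psd S_le f e2.
pose N := maxn N1 N2.
have {}HN1 n : (N <= n)%N -> nrm (rho *: pow n.+1 f - g) <= e / (2 * rho).
  move=> Nn; have := HN1 n (leq_trans (leq_maxl _ _) Nn).
  by rewrite sub0r normrN ger0_norm ?nrm_ge0.
have A_nrm h : nrm (A h) <= rho * nrm h.
  by rewrite AS nrmZ// gtr0_norm// ler_pM2l// nrm_contract.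
have e2E : rho * (e / (2 * rho)) = e / 2 by field; rewrite gt_eqF.
rewrite -(subrK (A (rho *: pow N.+1 f)) (A g)) -addrA.
apply: le_trans (nrmD ipP _ _) _.
rewrite [leRHS](_ : _ = e / 2 + e / 2); last by field.
apply: lerD.
  rewrite -(linB Alin); apply: le_trans (A_nrm _) _.
  by rewrite nrm_dist// -e2E ler_pM2l// HN1.
rewrite linZ// -scalerBr nrmZ// gtr0_norm// AS -iterS -e2E ler_pM2l//.
by rewrite HN1.
Qed.

End attained.
End top_eigenvector.

(** * Removing known eigenvectors *)

Section deflation.
Variables (R : realType) (V : lmodType R) (ip : V -> V -> R).
Hypothesis ipP : semi_inner ip.
Local Notation nrm := (nrm ip).

(** The supremum of the form on the unit ball is either 0 or, by
    [top_eigenvector], an eigenvalue, so that a bound of the eigenvalues bounds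
    the form. *)
Lemma psd_form_le A r : psd_operator ip A -> finite_rank_approx ip A ->
  completing ip A -> 0 <= r ->
  (forall rho g, 0 < rho -> 0 < nrm g -> nrm (A g - rho *: g) = 0 -> rho <= r) ->
  forall f, ip (A f) f <= r * ip f f.
Proof.
move=> A_psd A_fr A_compl r0 Hr.
have [Alin _ Apos] := A_psd.
pose E := [set x | exists2 f, ip f f <= 1 & x = ip (A f) f].
have E0 : E 0 by exists 0; rewrite ?ip0r.
have Eub : has_ubound E.
  have [n [u [v Huv]]] := A_fr 1 ltr01.
  exists (1 + \sum_i nrm (u i) * nrm (v i)) => _ [f f1 ->].
  have nf := nrm_le1 ipP f1.
  apply: le_trans (ler_norm _) _; apply: le_trans (ip_le_nrm ipP _ _) _.
  rewrite -[leRHS]mulr1; apply: ler_pM; rewrite ?nrm_ge0//.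
  rewrite -(subrK (\sum_i ip (u i) f *: v i) (A f)).
  apply: le_trans (nrmD ipP _ _) _; apply: lerD.
    by apply: le_trans (Huv f) _; rewrite mul1r.
  apply: le_trans (nrm_sum ipP _ _ _) _; apply: ler_sum => i _.
  rewrite (nrmZ ipP) ler_wpM2r ?nrm_ge0//; apply: le_trans (ip_le_nrm ipP _ _) _.
  by rewrite ler_piMr// nrm_ge0.
have supE : has_sup E by split=> //; exists 0.
pose rho := sup E.
have Ele f : ip f f <= 1 -> ip (A f) f <= rho.
  by move=> f1; apply: ub_le_sup => //; exists f.
have A_le f : ip (A f) f <= rho * ip f f.
  have [f0|f0] := eqVneq (nrm f) 0.
    by rewrite (ipC ipP (A f)) !(nrm_eq0_ip ipP)// mulr0.
  have := Ele ((nrm f)^-1 *: f).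
  rewrite (linZ Alin) !(ipZl ipP) !(ipZr ipP) -(nrm_sqr ipP f).
  rewrite (_ : _ * (_ * nrm f ^+ 2) = 1); last by field.
  rewrite lexx mulrA -expr2 exprVn ler_pdivrMl ?exprn_gt0//.
    by rewrite mulrC => /(_ isT).
  by rewrite lt_neqAle eq_sym f0 nrm_ge0.
have rho_ge0 : 0 <= rho by apply: ub_le_sup.
have [rho0|rho0] := eqVneq rho 0.
  move=> f; apply: le_trans (A_le f) _; rewrite rho0 mul0r mulr_ge0//.
  exact: (ip_ge0 ipP).
have {}rho0 : 0 < rho by rewrite lt_neqAle eq_sym rho0.
have A_sup t : t < rho -> exists f, ip f f <= 1 /\ t < ip (A f) f.
  move=> trho; have [_ [f f1 ->] H] := sup_adherent (ltr0Sn R 0 : 0 < 1) supE.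
  have [_ [g g1 ->]] : exists2 e, E e & sup E - (rho - t) < e.
    by apply: sup_adherent; rewrite ?subr_gt0.
  by rewrite subKr => tg; exists g.
have [g [g0 Ag]] := top_eigenvector ipP A_psd A_fr A_compl rho0 A_le A_sup.
move=> f; apply: le_trans (A_le f) _; rewrite ler_wpM2r ?(ip_ge0 ipP)//.
exact: Hr Ag.
Qed.

Variables (K : V -> V) (I : finType) (P : pred I) (e : I -> V) (lam : I -> R).
Hypotheses (K_psd : psd_operator ip K) (K_fr : finite_rank_approx ip K).
Hypothesis K_compl : completing ip K.
Hypothesis eO : forall i j, P i -> P j -> ip (e i) (e j) = (i == j)%:R.
Hypothesis eK : forall i, P i -> forall g, ip (K (e i)) g = lam i * ip (e i) g.
Local Notation res := (residual ip P e).

Let Klin : linear K. Proof. by case: K_psd. Qed.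
Let Ksym f g : ip (K f) g = ip f (K g). Proof. by case: K_psd. Qed.
Let Kpos f : 0 <= ip (K f) f. Proof. by case: K_psd. Qed.

Lemma ip_deflated f g : ip (K (res f)) g =
  ip (K f) g - \sum_(i | P i) lam i * ip f (e i) * ip g (e i).
Proof.
rewrite Ksym (ip_residual_l ipP) -Ksym; congr (_ - _).
apply: eq_bigr => i Pi.
by rewrite Ksym (ipC ipP g) eK// (ipC ipP g); ring.
Qed.

Lemma psd_deflated : psd_operator ip (K \o res).
Proof.
split=> [a f g|f g|f] /=.
- by rewrite (residual_linear ipP) Klin.
- rewrite (ipC ipP f) !ip_deflated (ipC ipP _ f) Ksym; congr (_ - _).
  by apply: eq_bigr => i _; ring.
- suff -> : ip (K (res f)) f = ip (K (res f)) (res f) by exact: Kpos.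
  rewrite [X in _ = ip _ X]/residual (ipBr ipP) (ip_sumr ipP) big1 ?subr0// => i Pi.
  rewrite (ipZr ipP) Ksym (ipC ipP (res f)) eK// (ipC ipP (e i)).
  by rewrite (residual_ortho ipP eO)// !mulr0.
Qed.

Lemma finite_rank_deflated : finite_rank_approx ip (K \o res).
Proof.
move=> d d0; have [n [u [v H]]] := K_fr d0.
exists n, (fun i => res (u i)), v => f /=.
under eq_bigr do rewrite (residual_sym ipP).
by apply: le_trans (H _) _; rewrite ler_pM2l// (nrm_residual ipP).
Qed.

Lemma completing_deflated : completing ip (K \o res).
Proof.
move=> f fC; apply: (K_compl (f := res \o f)) => d d0.
have [N HN] := fC _ d0; exists N => m n Nm Nn /=.
rewrite -(linB (residual_linear ipP P e)).
by apply: le_trans (nrm_residual ipP eO _) (HN _ _ Nm Nn).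
Qed.

(** Composing K with the projection off the e i leaves an operator to which
    [psd_form_le] applies, and whose eigenvectors for positive eigenvalues are
    eigenvectors of K orthogonal to the e i. *)
Lemma deflated_form_le r : 0 <= r ->
  (forall rho g, 0 < rho -> 0 < nrm g -> nrm (K g - rho *: g) = 0 ->
     (forall i, P i -> ip g (e i) = 0) -> rho <= r) ->
  forall f, ip (K f) f <= \sum_(i | P i) lam i * ip f (e i) ^+ 2 + r * ip f f.
Proof.
move=> r0 Hr f; rewrite -lerBlDl.
rewrite (_ : _ - _ = ip ((K \o res) f) f); last first.
  by rewrite ip_deflated; congr (_ - _); apply: eq_bigr => i _; ring.
move: f; apply: psd_form_le => //.
- exact: psd_deflated.
- exact: finite_rank_deflated.
- exact: completing_deflated.
move=> rho g rho0 g0 /= Kg.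
have ge i : P i -> ip g (e i) = 0.
  move=> Pi; have := nrm_eq0_ip ipP (e i) Kg.
  rewrite (ipBl ipP) Ksym (ipC ipP (res g)) eK// (ipC ipP (e i)) (residual_ortho ipP eO)//.
  rewrite mulr0 sub0r (ipZl ipP) => /eqP.
  by rewrite oppr_eq0 mulf_eq0 (gt_eqF rho0) => /eqP.
have resg : res g = g.
  by rewrite /residual big1 ?subr0// => i Pi; rewrite ge// scale0r.
by apply: Hr ge => //; rewrite -{1}resg.
Qed.

End deflation.

(** * The space of square integrable functions *)

Lemma lee12 (R : realType) : (1 <= 2%:E :> \bar R)%E.
Proof. by rewrite lee_fin ler1n. Qed.

Notation L2 mu := (LfunType mu (lee12 _)).

Section L2.
Context d (T : measurableType d) (R : realType) (mu : probability T R).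
Implicit Types f g : L2 mu.

Definition ip2 f g : R := inner mu setT f g.

Lemma integrable_mul f g : mu.-integrable setT (EFin \o (fun x => f x * g x)).
Proof. exact/Lfun1_integrable/Lfun2_mul_Lfun1/LfunP/LfunP. Qed.

Lemma ip2P : semi_inner ip2.
Proof.
split=> [f g|f g h|a f g|f].
- by apply: eq_Rintegral => x _; rewrite mulrC.
- rewrite /ip2 /inner -RintegralD//; [|exact: integrable_mul..].
  by apply: eq_Rintegral => x _; rewrite /= mulrDl.
- rewrite /ip2 /inner -RintegralZl//; [|exact: integrable_mul].
  by apply: eq_Rintegral => x _; rewrite /= mulrA.
- by apply: Rintegral_ge0 => x _; rewrite -expr2 sqr_ge0.
Qed.

Lemma Lfun2P (f : T -> R) : measurable_fun setT f ->
  (\int[mu]_x (f x ^+ 2)%:E < +oo)%E -> f \in Lfun mu 2%:E.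
Proof.
move=> mf fi; rewrite inE; apply/andP; split; rewrite inE//=.
rewrite /finite_norm unlock /= poweR_lty//.
by under eq_integral do rewrite powR_mulrn// real_normK ?num_real//.
Qed.

Lemma bounded_Lfun2 (f : T -> R) M : measurable_fun setT f ->
  (forall x, `|f x| <= M) -> f \in Lfun mu 2%:E.
Proof.
move=> mf fM; apply: Lfun2P => //.
apply: (@le_lt_trans _ _ (\int[mu]_x (M ^+ 2)%:E)%E).
  apply: ge0_le_integral => //=.
  - by move=> x _; rewrite lee_fin sqr_ge0.
  - exact/measurable_EFinP/measurable_funX.
  - move=> x _; rewrite lee_fin -real_normK ?num_real//.
    by rewrite ler_sqr ?nnegrE// (le_trans _ (fM x)).
by rewrite integral_cst//=; have -> := probability_setT mu; rewrite mule1 ltry.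
Qed.

Lemma bounded_integrable (f : T -> R) M : measurable_fun setT f ->
  (forall x, `|f x| <= M) -> mu.-integrable setT (EFin \o f).
Proof.
move=> mf fM; apply/Lfun1_integrable.
have := Lfun_subset12 (mu := mu) (fin_num_measure mu setT measurableT).
by apply; exact: bounded_Lfun2 fM.
Qed.

Lemma L2_integrable f : mu.-integrable setT (EFin \o f).
Proof.
apply/Lfun1_integrable.
have := Lfun_subset12 (mu := mu) (fin_num_measure mu setT measurableT).
by apply; exact: LfunP.
Qed.

Lemma ip2_ae f f' g : ae_eq mu setT f f' -> ip2 f g = ip2 f' g.
Proof.
move=> ff'; rewrite /ip2 /inner /Rintegral; congr fine.
apply: ae_eq_integral => //.
- exact/measurable_EFinP/measurable_funM.
- exact/measurable_EFinP/measurable_funM.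
by apply: filterS ff' => x /= H xT; rewrite H.
Qed.

Lemma nrm0_ae f : nrm ip2 f = 0 -> ae_eq mu setT f (cst 0).
Proof.
move=> /eqP; rewrite sqrtr_eq0 => f0.
have : (\int[mu]_x (f x * f x)%:E = 0)%E.
  have ffin := integrable_fin_num measurableT (integrable_mul f f).
  rewrite -[LHS]fineK//; congr (_%:E); apply/eqP; rewrite eq_le f0/=.
  exact: (ip_ge0 ip2P).
move=> f2; have mf : measurable_fun setT (EFin \o (fun x => f x * f x)).
  exact/measurable_EFinP/measurable_funM.
have /(ae_eq_integral_abs mu measurableT mf) : (\int[mu]_x `|(f x * f x)%:E| = 0)%E.
  rewrite -[RHS]f2; apply: eq_integral => x _ /=.
  by rewrite ger0_norm// -expr2 sqr_ge0.
by apply: filterS => x /= H xT; have [/eqP] := H xT; rewrite mulf_eq0 orbb => /eqP.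
Qed.

Lemma ip2_L1 f g : `|\int[mu]_x (f x * g x)| <= nrm ip2 f * nrm ip2 g.
Proof. exact: (ip_le_nrm ip2P). Qed.

Lemma bounded_mul_integrable (h : T -> R) M f : measurable_fun setT h ->
  (forall x, `|h x| <= M) -> mu.-integrable setT (EFin \o (fun x => h x * f x)).
Proof.
move=> mh hM; apply/Lfun1_integrable.
exact: (Lfun2_mul_Lfun1 (bounded_Lfun2 mh hM) (LfunP f)).
Qed.

Lemma nrm_bounded f M : 0 <= M -> (forall x, `|f x| <= M) -> nrm ip2 f <= M.
Proof.
move=> M0 fM; rewrite -ler_sqr ?nnegrE ?nrm_ge0// (nrm_sqr ip2P).
apply: (@le_trans _ _ (\int[mu]_x (cst (M ^+ 2) x))).
  apply: le_Rintegral => //; first exact: integrable_mul.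
    exact: (bounded_integrable (M := `|M ^+ 2|)).
  move=> x _ /=; rewrite -expr2 -real_normK ?num_real//.
  by rewrite ler_sqr ?nnegrE// (le_trans _ (fM x)).
rewrite Rintegral_cst// [X in _ * X](_ : _ = 1) ?mulr1//.
exact: (congr1 fine (probability_setT mu)).
Qed.

Lemma L2_sumE (I : Type) (s : seq I) (P : pred I) (F : I -> L2 mu) t :
  (\sum_(i <- s | P i) F i) t = \sum_(i <- s | P i) F i t.
Proof. by elim/big_rec2: _ => [//|i x y _ <-]. Qed.

Definition one2 : L2 mu := Lfun_Sub (lee12 R) (Lfun_cst mu 1 2).

Lemma ip_one2 f : ip2 f one2 = \int[mu]_t f t.
Proof. by apply: eq_Rintegral => t _; rewrite /= mulr1. Qed.

End L2.
Arguments ip2P {d T R mu}.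

(** * Integral operators *)

Section kernel_operator.
Context d (T : measurableType d) (R : realType) (mu : probability T R).
Variables (k : T -> T -> R) (M : R).
Hypothesis k_meas : measurable_fun setT (fun p : T * T => k p.1 p.2).
Hypothesis k_bnd : forall t s, `|k t s| <= M.
Hypothesis k_sym : forall t s, k t s = k s t.
Hypothesis k_psd : forall n (r : 'I_n -> T) (c : 'I_n -> R),
  0 <= \sum_i \sum_j c i * c j * k (r i) (r j).
Hypothesis k_step : forall e : R, 0 < e ->
  exists n (idx : T -> 'I_n) (r : 'I_n -> T),
    (forall i, measurable (idx @^-1` [set i])) /\
    forall t s, `|k t s - k (r (idx t)) (r (idx s))| <= e.

Implicit Types f g : L2 mu.
Local Notation ip := (@ip2 _ T R mu).
Local Notation nrm := (nrm ip).

Let M_ge0 : 0 <= M.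
Proof.
have [n [idx [r _]]] := k_step ltr01.
have [t _] : [set: T] !=set0.
  apply/set0P/eqP => T0; have := probability_setT mu; rewrite T0 measure0.
  by move=> /eqP; rewrite eqe eq_sym oner_eq0.
exact: le_trans (k_bnd t t).
Qed.

Lemma measurable_section t : measurable_fun setT (k t).
Proof. exact: (measurableT_comp k_meas (measurable_pair1 t)). Qed.

Lemma section_integrable t f : mu.-integrable setT (EFin \o (fun s => k t s * f s)).
Proof. exact: bounded_mul_integrable (measurable_section t) (k_bnd t). Qed.

Definition kernel_fun f t := \int[mu]_s (k t s * f s).

Lemma kernel_integrable f g : (mu \x mu)%E.-integrable setT
  (EFin \o (fun p : T * T => k p.1 p.2 * (g p.1 * f p.2))).
Proof.
have mgf : measurable_fun setT (fun p : T * T => g p.1 * f p.2).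
  apply: measurable_funM.
  - exact: (measurableT_comp (measurable_funPT g) measurable_fst).
  - exact: (measurableT_comp (measurable_funPT f) measurable_snd).
apply: (@le_integrable _ _ _ _ _ measurableT _
  (EFin \o (fun p : T * T => M * g p.1 * f p.2))).
- exact/measurable_EFinP/measurable_funM.
- move=> p _; rewrite lee_fin -mulrA normrM [leRHS]normrM ler_wpM2r//.
  by rewrite (le_trans (k_bnd _ _))// ler_norm.
apply: (integrable_tensor (a := fun x => M * g x) (b := f)); last exact: L2_integrable.
exact: (integrableZl measurableT M (L2_integrable g)).
Qed.

Lemma kernel_fun_bounded f t : `|kernel_fun f t| <= M * nrm f.
Proof.
pose kt : L2 mu := Lfun_Sub (lee12 R) (bounded_Lfun2 mu (measurable_section t) (k_bnd t)).
apply: le_trans (ip2_L1 kt f) _; rewrite ler_wpM2r ?nrm_ge0//.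
by apply: nrm_bounded => [|s]; [exact: M_ge0|exact: k_bnd].
Qed.

Lemma measurable_kernel_fun f : measurable_fun setT (kernel_fun f).
Proof.
have := measurable_Rintegral1 (kernel_integrable f (one2 mu)).
by under eq_fun do under eq_Rintegral do rewrite /= mul1r.
Qed.

Definition kernel_op f : L2 mu := Lfun_Sub (lee12 R)
  (bounded_Lfun2 mu (measurable_kernel_fun f) (kernel_fun_bounded f)).

Lemma kernel_op_linear : linear kernel_op.
Proof.
move=> a f g; apply/LfuneqP => t.
transitivity (a * kernel_fun f t + kernel_fun g t); last by [].
rewrite [LHS]/= /kernel_fun -RintegralZl//; last exact: section_integrable.
rewrite -RintegralD//; last 2 first.
- exact: (integrableZl measurableT a (section_integrable t f)).
- exact: section_integrable.
apply: eq_Rintegral => s _; rewrite -[(a *: f + g) s]/(a * f s + g s); ring.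
Qed.

Lemma kernel_op_sym f g : ip (kernel_op f) g = ip f (kernel_op g).
Proof.
rewrite (ipC ip2P f) /ip2 /inner /=.
transitivity (\int[mu]_t \int[mu]_s (k t s * (g t * f s))).
  apply: eq_Rintegral => t _; rewrite -RintegralZr//; last exact: section_integrable.
  by apply: eq_Rintegral => s _; ring.
rewrite (Rfubini (kernel_integrable f g)).
apply: eq_Rintegral => s _ /=; rewrite -RintegralZr//; last exact: section_integrable.
by apply: eq_Rintegral => t _; rewrite k_sym; ring.
Qed.

(** The operator turns mean square convergence into uniform convergence, and
    uniform limits of bounded measurable functions stay in the space. *)
Lemma kernel_op_completing : completing ip kernel_op.
Proof.
move=> f fC.
have dK m n t : `|kernel_op (f m) t - kernel_op (f n) t| <= M * nrm (f m - f n).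
  rewrite -[X in `|X|]/((kernel_op (f m) - kernel_op (f n)) t).
  by rewrite -(linB kernel_op_linear) kernel_fun_bounded.
have dKe (e : R) : 0 < e -> exists N, forall t m n, (N <= m)%N -> (N <= n)%N ->
    `|kernel_op (f m) t - kernel_op (f n) t| <= e.
  move=> e0; have M1 : 0 < M + 1 by rewrite ltr_wpDl.
  have [N HN] := fC _ (divr_gt0 e0 M1).
  exists N => t m n Nm Nn; apply: le_trans (dK _ _ _) _.
  apply: le_trans (_ : (M + 1) * (e / (M + 1)) <= _).
    by rewrite ler_pM ?nrm_ge0 ?lerDl// HN.
  by rewrite mulrC divfK// gt_eqF.
pose g t := limn (fun n => kernel_op (f n) t).
have gl t : kernel_op (f n) t @[n --> \oo] --> g t.
  apply/cauchy_cvgP/cauchy_exP => e e0.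
  have [N HN] := dKe _ (divr_gt0 e0 (ltr0Sn R 1)).
  exists (kernel_op (f N) t); exists N => // n /= Nn.
  rewrite /ball /=; apply: le_lt_trans (HN t N n _ Nn) _ => //.
  by rewrite ltr_pdivrMr// mulr_natr mulr2n ltrDl.
have gd (e : R) : 0 < e -> exists N, forall t n, (N <= n)%N ->
    `|kernel_op (f n) t - g t| <= e.
  move=> /dKe[N HN]; exists N => t n Nn.
  have H : `|kernel_op (f n) t - kernel_op (f m) t| @[m --> \oo] -->
      `|kernel_op (f n) t - g t|.
    by apply: cvg_norm; apply: cvgB; [exact: cvg_cst|exact: gl].
  rewrite -(cvg_lim _ H)//; apply: limr_le; first by apply: cvgP H.
  by exists N => // m /= Nm; exact: HN.
have mg : measurable_fun setT g.
  by apply: (measurable_fun_cvg (h := fun n => kernel_op (f n))) => // t _; exact: gl.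
have [N HN] := gd _ ltr01.
have gb t : `|g t| <= M * nrm (f N) + 1.
  rewrite -(subrK (kernel_op (f N) t) (g t)) addrC.
  apply: le_trans (ler_normD _ _) _; rewrite lerD ?kernel_fun_bounded//.
  by rewrite distrC HN.
pose g2 : L2 mu := Lfun_Sub (lee12 R) (bounded_Lfun2 mu mg gb).
exists g2; apply/cvgrPdist_le => e e0; have [N' HN'] := gd _ e0.
exists N' => // n /= Nn; rewrite sub0r normrN ger0_norm ?nrm_ge0//.
by apply: nrm_bounded => [|t]; [exact: ltW|exact: HN'].
Qed.

Definition section2 t : L2 mu :=
  Lfun_Sub (lee12 R) (bounded_Lfun2 mu (measurable_section t) (k_bnd t)).

Section steps.
Variables (n : nat) (idx : T -> 'I_n) (r : 'I_n -> T) (e : R).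
Hypothesis idx_meas : forall i, measurable (idx @^-1` [set i]).
Hypothesis k_near : forall t s, `|k t s - k (r (idx t)) (r (idx s))| <= e.

Lemma measurable_cell i : measurable_fun setT (fun t => (idx t == i)%:R : R).
Proof.
rewrite (_ : (fun t => _) = \1_(idx @^-1` [set i])); first exact: measurable_indic.
apply/funext => t; rewrite indicE; congr (_%:R); congr nat_of_bool.
by apply/eqP/idP => [<-|]; rewrite inE.
Qed.

Lemma cell_bounded i t : `|(idx t == i)%:R : R| <= 1.
Proof. by case: eqP; rewrite ?normr1 ?normr0. Qed.

Definition cell i : L2 mu :=
  Lfun_Sub (lee12 R) (bounded_Lfun2 mu (measurable_cell i) (cell_bounded i)).

Lemma cellE i t : cell i t = (idx t == i)%:R. Proof. by []. Qed.

Lemma step_sumE (h : 'I_n -> R) t : (\sum_i h i *: cell i) t = h (idx t).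
Proof.
rewrite L2_sumE (bigD1 (idx t))//= big1 ?addr0 => [|i it].
  by rewrite -[LHS]/(h (idx t) * cell (idx t) t) cellE eqxx mulr1.
by rewrite -[LHS]/(h i * cell i t) cellE eq_sym (negbTE it) mulr0.
Qed.

Let row i := \sum_j k (r i) (r j) *: cell j.

Lemma ip_row i f : ip (row i) f = \sum_j k (r i) (r j) * ip (cell j) f.
Proof. by rewrite (ip_suml ip2P); apply: eq_bigr => j _; rewrite (ipZl ip2P). Qed.

(** Both variables are replaced by representatives of their cells, which moves
    the kernel by at most e uniformly. *)
Lemma kernel_op_step f : 0 <= e ->
  nrm (kernel_op f - \sum_i ip (row i) f *: cell i) <= e * nrm f.
Proof.
move=> e0; apply: nrm_bounded => [|t]; first by rewrite mulr_ge0 ?nrm_ge0.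
rewrite -[X in `|X|]/(ip (section2 t) f - (\sum_i ip (row i) f *: cell i) t).
rewrite step_sumE -(ipBl ip2P); apply: le_trans (ip_le_nrm ip2P _ _) _.
rewrite ler_wpM2r ?nrm_ge0//; apply: nrm_bounded => // s.
rewrite -[X in `|X|]/(k t s - row (idx t) s) step_sumE; exact: k_near.
Qed.

(** The form of the step kernel is the form of the matrix k (r i) (r j) on the
    integrals of f over the cells; this transfers positivity from finite sets
    of points to functions. *)
Lemma kernel_op_almost_ge0 f : 0 <= e -> - (e * ip f f) <= ip (kernel_op f) f.
Proof.
move=> e0; rewrite -(subrK (\sum_i ip (row i) f *: cell i) (kernel_op f)).
rewrite (ipDl ip2P) -[leLHS]addr0; apply: lerD.
  rewrite lerNl; apply: le_trans (ler_norm _) _; rewrite normrN.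
  apply: le_trans (ip_le_nrm ip2P _ _) _.
  by rewrite -(nrm_sqr ip2P) expr2 mulrA ler_wpM2r ?nrm_ge0// kernel_op_step.
rewrite (ip_suml ip2P); apply: le_trans (k_psd r (fun i => ip (cell i) f)) _.
rewrite le_eqVlt; apply/orP; left; apply/eqP; apply: eq_bigr => i _.
rewrite (ipZl ip2P) ip_row mulr_suml; apply: eq_bigr => j _; ring.
Qed.

Definition mass i := ip (cell i) (cell i).
(** A null cell gives the zero function, the inverse of 0 being 0. *)
Definition unit_cell i := (Num.sqrt (mass i))^-1 *: cell i.

Lemma ip_cell_one i : ip (cell i) (one2 mu) = mass i.
Proof. by apply: eq_Rintegral => t _ /=; case: eqP; rewrite ?mulr1 ?mulr0. Qed.

Lemma ip_cell i j : i != j -> ip (cell i) (cell j) = 0.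
Proof.
move=> ij; rewrite /ip2 /inner (@eq_Rintegral _ _ _ mu setT (cst 0)) ?Rintegral_cst// ?mul0r//.
move=> t _ /=; case: eqP => [->|]; rewrite ?mul0r// (negbTE ij) mulr0//.
Qed.

Lemma unit_cell_orthonormal i j : mass i != 0 -> mass j != 0 ->
  ip (unit_cell i) (unit_cell j) = (i == j)%:R.
Proof.
move=> mi mj; rewrite (ipZl ip2P) (ipZr ip2P).
have [<-|ij] := eqVneq i j; last by rewrite ip_cell// !mulr0.
have m0 : 0 < mass i by rewrite lt_neqAle eq_sym mi (ip_ge0 ip2P).
by rewrite -[ip _ _]/(mass i) mulrA -expr2 exprVn sqr_sqrtr ?(ltW m0)// mulVf.
Qed.

Lemma unit_cell0 i : mass i = 0 -> unit_cell i = 0.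
Proof. by move=> m0; rewrite /unit_cell m0 sqrtr0 invr0 scale0r. Qed.

Lemma sum_mass : \sum_i mass i = 1.
Proof.
have -> : \sum_i mass i = ip (\sum_i 1 *: cell i) (one2 mu).
  by rewrite (ip_suml ip2P); apply: eq_bigr => i _; rewrite scale1r ip_cell_one.
rewrite ip_one2 (@eq_Rintegral _ _ _ mu setT (cst 1)); last by move=> t _; rewrite step_sumE.
rewrite Rintegral_cst// mul1r; exact: (congr1 fine (probability_setT mu)).
Qed.

Lemma mass_kernel i : (k (r i) (r i) - e) * mass i <= ip (kernel_op (unit_cell i)) (unit_cell i).
Proof.
have [m0|mi] := eqVneq (mass i) 0.
  by rewrite m0 mulr0 unit_cell0// (ip0r ip2P).
have m0 : 0 < mass i by rewrite lt_neqAle eq_sym mi (ip_ge0 ip2P).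
have H : (k (r i) (r i) - e) * mass i * mass i <= ip (kernel_op (cell i)) (cell i).
  rewrite /mass -!RintegralZl//; [|exact: integrable_mul..].
  apply: le_Rintegral => //; [|exact: integrable_mul|].
    exact: (integrableZl measurableT _ (integrable_mul (cell i) (cell i))).
  move=> t _; rewrite !cellE; case: eqP => ti; last by rewrite !mulr0.
  rewrite !mulr1; apply: le_Rintegral => //; [|exact: section_integrable|].
    exact: (integrableZl measurableT _ (integrable_mul (cell i) (cell i))).
  move=> s _; rewrite !cellE; case: eqP => si; last by rewrite !mulr0.
  rewrite !mulr1; have := k_near t s; rewrite ti si ler_norml => /andP[]; lra.
rewrite /unit_cell (linZ kernel_op_linear) (ipZl ip2P) (ipZr ip2P) mulrA -expr2.
by rewrite exprVn sqr_sqrtr ?(ltW m0)// ler_pdivlMl// mulrC.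
Qed.

(** On each cell the diagonal is within e of k (r i) (r i), and so are the values
    of k that enter the form at the normalized cell. *)
Lemma trace_le_cells : \int[mu]_t k t t <=
  \sum_i ip (kernel_op (unit_cell i)) (unit_cell i) + 2 * e.
Proof.
have mdiag : measurable_fun setT (fun t => k t t).
  have mp : measurable_fun setT (fun t : T => (t, t)) by exact: measurable_fun_pair.
  exact: (measurableT_comp k_meas mp).
pose w : L2 mu := \sum_i k (r i) (r i) *: cell i + e *: (one2 mu).
apply: (@le_trans _ _ (\int[mu]_t w t)).
  apply: le_Rintegral => //; last 2 first.
  - exact: L2_integrable.
  - move=> t _; rewrite -[w t]/((\sum_i k (r i) (r i) *: cell i) t + e * 1) step_sumE.
    by have := k_near t t; rewrite ler_norml => /andP[]; lra.
  by apply: (@bounded_integrable _ _ _ mu _ M mdiag).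
rewrite -ip_one2 (ipDl ip2P) (ipZl ip2P) (ip_suml ip2P).
have -> : ip (one2 mu) (one2 mu) = 1.
  by rewrite -sum_mass ip_one2 Rintegral_cst// mul1r sum_mass; exact: (congr1 fine (probability_setT mu)).
rewrite mulr1 (_ : 2 * e = e * (\sum_i mass i) + e); last by rewrite sum_mass; ring.
rewrite addrA.
rewrite lerD2r mulr_sumr -big_split/=; apply: ler_sum => i _.
by rewrite (ipZl ip2P) ip_cell_one -lerBlDr -mulrBl mass_kernel.
Qed.

(** Test the bound of the form on the n orthonormal normalized cells: by Bessel
    each lam i is counted at most once, and the remainder c at most n times. *)
Lemma trace_le_spectrum (I : finType) (P : pred I) (v : I -> L2 mu) (lam : I -> R) c :
  (forall i, 0 <= lam i) ->
  (forall i, P i -> ip (v i) (v i) = 1) -> 0 <= c ->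
  (forall f, ip (kernel_op f) f <= \sum_(i | P i) lam i * ip f (v i) ^+ 2 + c * ip f f) ->
  \int[mu]_t k t t <= \sum_(i | P i) lam i + n%:R * c + 2 * e.
Proof.
move=> lam0 v1 c0 H; apply: le_trans trace_le_cells _; rewrite lerD2r.
rewrite (bigID (fun i => mass i != 0))/= [X in _ + X]big1 ?addr0; last first.
  by move=> i /negbNE/eqP m0; rewrite unit_cell0// (ip0r ip2P).
apply: le_trans (ler_sum _ (fun i _ => H (unit_cell i))) _.
rewrite big_split/= lerD//.
  rewrite exchange_big/=; apply: ler_sum => i Pi.
  rewrite -mulr_sumr ler_piMr// -(v1 i Pi).
  under eq_bigr do rewrite (ipC ip2P).
  exact: (bessel ip2P unit_cell_orthonormal).
rewrite (eq_bigr (fun=> c)); last first.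
  by move=> i mi; rewrite unit_cell_orthonormal// eqxx mulr1.
rewrite sumr_const mulr_natl -[leRHS]mulr_natl -[leLHS]mulr_natl.
by rewrite ler_wpM2r// ler_nat; apply: leq_trans (max_card _) _; rewrite card_ord.
Qed.

End steps.

Lemma kernel_op_psd : psd_operator ip kernel_op.
Proof.
split=> [||f]; [exact: kernel_op_linear|exact: kernel_op_sym|].
apply/ler_addgt0Pr => x x0.
have fp : 0 < ip f f + 1 by rewrite ltr_wpDl// (ip_ge0 ip2P).
have e0 : 0 < x / (ip f f + 1) by rewrite divr_gt0.
have [n [idx [r [mi kn]]]] := k_step e0.
have := kernel_op_almost_ge0 mi kn f (ltW e0).
rewrite -subr_ge0 opprK => /le_trans; apply; rewrite lerD2l.
by rewrite mulrAC ler_pdivrMr// ler_wpM2l ?(ltW x0)// lerDl.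
Qed.

Lemma kernel_op_finite_rank : finite_rank_approx ip kernel_op.
Proof.
move=> e e0; have [n [idx [r [mi kn]]]] := k_step e0.
exists n, (fun i => \sum_j k (r i) (r j) *: cell mi j), (cell mi) => f.
exact: (kernel_op_step mi kn) (ltW e0).
Qed.

End kernel_operator.

(** * Continuous covariance kernels on the unit interval *)

Section unit_interval.
Variable R : realType.
Local Notation I01 := (`[0, 1]%classic : set R).

(** Heine-Cantor, on a compact square. *)
Lemma unit_square_unif (f : R * R -> R) (e : R) :
  {within I01 `*` I01, continuous f} -> 0 < e ->
  exists n, forall x y, (I01 `*` I01) x -> (I01 `*` I01) y ->
    `|x.1 - y.1| < n.+1%:R^-1 -> `|x.2 - y.2| < n.+1%:R^-1 -> `|f x - f y| <= e.
Proof.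
move=> /subspace_continuousP cf e0.
have cA : compact (I01 `*` I01) by apply: compact_setX; exact: segment_compact.
have /(near_covering_withinP _).2 := (compact_near_coveringP _).1 cA.
pose P (n : nat) x := forall y, (I01 `*` I01) y ->
  `|x.1 - y.1| < n.+1%:R^-1 -> `|x.2 - y.2| < n.+1%:R^-1 -> `|f x - f y| <= e.
move=> /(_ nat \oo P _); case; last first.
  by move=> n _ /(_ n (leqnn _)) H; exists n => x y Ax; exact: H.
move=> x Ax; have e2 : 0 < e / 2 by rewrite divr_gt0.
have /cvgrPdist_le/(_ _ e2) := cf x Ax.
rewrite near_withinE => /nbhs_ballP[d /= d0 Hd]; have d2 : 0 < d / 2 by rewrite divr_gt0.
have n2 : \forall n \near \oo, n.+1%:R^-1 < d / 2.
  exact: (near_infty_natSinv_lt (PosNum d2)).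
exists (ball x (d / 2), [set n | n.+1%:R^-1 < d / 2]).
  by split => //; exact: nbhsx_ballx.
move=> [x' n] /= [[x1 x2] nd] Ax' y Ay d1 d2'.
have H1 : `|f x - f x'| <= e / 2.
  apply: (Hd x') => //; split; rewrite /ball /=.
    by apply: lt_trans x1 _; rewrite ltr_pdivrMr// ltr_pMr// ltr1n.
  by apply: lt_trans x2 _; rewrite ltr_pdivrMr// ltr_pMr// ltr1n.
have H2 : `|f x - f y| <= e / 2.
  apply: (Hd y) => //; split; rewrite /ball /=.
    rewrite -(subrK x'.1 x.1) -addrA; apply: le_lt_trans (ler_normD _ _) _.
    by rewrite [ltRHS]splitr; apply: ltrD => //; exact: lt_trans d1 _.
  rewrite -(subrK x'.2 x.2) -addrA; apply: le_lt_trans (ler_normD _ _) _.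
  by rewrite [ltRHS]splitr; apply: ltrD => //; exact: lt_trans d2' _.
rewrite -(subrK (f x) (f x')) -addrA; apply: le_trans (ler_normD _ _) _.
by rewrite [leRHS]splitr distrC lerD.
Qed.

(** Precomposing with the retraction of the line on [0, 1] makes a kernel that is
    continuous on the square into one that is bounded and uniformly close to
    step kernels on the whole plane, without changing it on the square. *)
Definition clamp (t : R) : R := Num.max 0 (Num.min t 1).

Lemma clamp01 t : I01 (clamp t).
Proof. by rewrite /= in_itv/= /clamp le_max lexx/= ge_max ler01 ge_min lexx orbT. Qed.

Lemma clamp_id t : I01 t -> clamp t = t.
Proof. by rewrite /= in_itv/= => /andP[t0 t1]; rewrite /clamp min_l// max_r. Qed.

Lemma measurable_clamp : measurable_fun setT clamp.
Proof. by apply: measurable_maxr => //; exact: measurable_minr. Qed.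

(** The mesh is 1 / (n + 2), strictly finer than 1 / (n + 1); one more cell is
    taken by the right endpoint 1 alone. *)
Lemma clamp_grid n : exists (idx : R -> 'I_n.+3) (r : 'I_n.+3 -> R),
  [/\ forall i, I01 (r i), forall i, measurable (idx @^-1` [set i]) &
      forall t, `|clamp t - r (idx t)| < n.+1%:R^-1].
Proof.
pose m : R := n.+2%:R.
have m0 : 0 < m by rewrite ltr0n.
have tr t : (Num.truncn (m * clamp t) < n.+3)%N.
  have := clamp01 t; rewrite /= in_itv/= => /andP[t0 t1].
  rewrite truncn_lt_nat ?mulr_ge0 ?(ltW m0)//.
  by apply: le_lt_trans (_ : m < _); rewrite ?ltr_nat// ger_pMr.
exists (fun t => Ordinal (tr t)), (fun i => i%:R / m); split.
- move=> i; rewrite /= in_itv/= divr_ge0 ?(ltW m0)// ler_pdivrMr// mul1r ler_nat.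
  by rewrite -ltnS ltn_ord.
- move=> i; rewrite (_ : _ @^-1` _ = (fun t => m * clamp t) @^-1` `[i%:R, i.+1%:R[).
    rewrite -[_ @^-1` _]setTI; apply: measurable_funM => //; exact: measurable_clamp.
  apply/seteqP; split => t /=.
    move=> <- /=; rewrite in_itv/= truncn_itv// mulr_ge0 ?(ltW m0)//.
    by have := clamp01 t; rewrite /= in_itv/= => /andP[].
  rewrite in_itv/= => H; apply/val_inj => /=; exact: truncn_def.
- move=> t /=; have := clamp01 t; rewrite /= in_itv/= => /andP[t0 t1].
  have /andP[] := truncn_itv (mulr_ge0 (ltW m0) t0).
  set j := Num.truncn _; rewrite -natr1 => j1 j2.
  have -> : clamp t - j%:R / m = (m * clamp t - j%:R) / m by field; rewrite gt_eqF.
  rewrite ger0_norm; last by rewrite divr_ge0 ?(ltW m0)// subr_ge0.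
  apply: (@lt_trans _ _ m^-1); first by rewrite ltr_pdivrMr// mulVf ?gt_eqF//; lra.
  by rewrite ltf_pV2 ?posrE// ltr_nat.
Qed.

Variable K : R -> R -> R.
Hypothesis K_cont : {within I01 `*` I01, continuous (fun ts : R * R => K ts.1 ts.2)}.

Definition clamped t s := K (clamp t) (clamp s).

Lemma clamped_step (e : R) : 0 < e ->
  exists n (idx : measurableTypeR R -> 'I_n) (r : 'I_n -> measurableTypeR R),
    (forall i, measurable (idx @^-1` [set i])) /\
    forall t s, `|clamped t s - clamped (r (idx t)) (r (idx s))| <= e.
Proof.
move=> e0; have [n Hn] := unit_square_unif K_cont e0.
have [idx [r [r01 mi near]]] := clamp_grid n.
exists n.+3, idx, r; split=> // t s; rewrite /clamped.
apply: (Hn (clamp t, clamp s) (clamp (r (idx t)), clamp (r (idx s)))) => /=.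
- by split; exact: clamp01.
- by split; exact: clamp01.
- by rewrite (clamp_id (r01 _)).
- by rewrite (clamp_id (r01 _)).
Qed.

End unit_interval.

(** * Covariance kernels and the trace formula on an interval *)

Section step_kernels.
Context d (T : measurableType d) (R : realType) (k : T -> T -> R).
Hypothesis k_step : forall e : R, 0 < e ->
  exists n (idx : T -> 'I_n) (r : 'I_n -> T),
    (forall i, measurable (idx @^-1` [set i])) /\
    forall t s, `|k t s - k (r (idx t)) (r (idx s))| <= e.

Lemma step_kernel_bounded : exists M : R, forall t s, `|k t s| <= M.
Proof.
have [n [idx [r [_ H]]]] := k_step ltr01.
exists (1 + \sum_i \sum_j `|k (r i) (r j)|) => t s.
rewrite -(subrK (k (r (idx t)) (r (idx s))) (k t s)).
apply: le_trans (ler_normD _ _) _; rewrite lerD//.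
rewrite (bigD1 (idx t))//= (bigD1 (idx s))//= -addrA lerDl addr_ge0 ?sumr_ge0// => i _.
exact: sumr_ge0.
Qed.

Lemma step_kernel_measurable : measurable_fun setT (fun p : T * T => k p.1 p.2).
Proof.
have H m : exists h : T * T -> R, measurable_fun setT h /\
    forall p, `|k p.1 p.2 - h p| <= m.+1%:R^-1.
  have m0 : 0 < m.+1%:R^-1 :> R by rewrite invr_gt0.
  have [n [idx [r [mi H]]]] := k_step m0.
  exists (fun p => k (r (idx p.1)) (r (idx p.2))); split=> [|p]; last exact: H.
  have -> : (fun p : T * T => k (r (idx p.1)) (r (idx p.2))) = fun p =>
        \sum_i \sum_j k (r i) (r j) * ((idx p.1 == i)%:R * (idx p.2 == j)%:R).
      apply/funext => p; rewrite (bigD1 (idx p.1))//= (bigD1 (idx p.2))//= !eqxx.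
      rewrite !mulr1 !big1 ?addr0// => [i ip|i ip]; last first.
        by rewrite [idx p.2 == i]eq_sym (negbTE ip) !mulr0.
      by rewrite big1// => j _; rewrite [idx p.1 == i]eq_sym (negbTE ip) mul0r mulr0.
    apply: measurable_sum => i; apply: measurable_sum => j.
    apply: measurable_funM => //; apply: measurable_funM.
    - exact: (measurableT_comp (measurable_cell mi i) measurable_fst).
    - exact: (measurableT_comp (measurable_cell mi j) measurable_snd).
pose h m := sval (cid (H m)).
have hP m := svalP (cid (H m)).
apply: (measurable_fun_cvg (h := h)) => [m|p _]; first by case: (hP m).
apply/cvgrPdist_le => e e0.
have := near_infty_natSinv_lt (PosNum e0); apply: filterS => n /ltW ne.
by apply: le_trans ne; case: (hP n).
Qed.

End step_kernels.

Section unit_measure.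
Variable R : realType.
Local Notation leb := (@lebesgue_measure R).
Local Notation I01 := (`[0, 1]%classic : set R).

Lemma leb01_full : leb01 (~` I01 : set (measurableTypeR R)) = 0%E.
Proof. by rewrite /leb01 /mrestr setICl measure0. Qed.

Lemma Rintegral_leb01 (f : R -> R) : measurable_fun [set: measurableTypeR R] f ->
  \int[leb]_(x in `[0, 1]) f x = \int[@leb01 R]_x f x.
Proof.
move=> mf; transitivity (\int[@leb01 R]_(x in I01) f x); last first.
  by apply: Rintegral_full => //; exact: leb01_full.
congr fine; apply: eq_measure_integral => A mA AI.
by have /(congr1 leb)/esym := setIidl AI; exact.
Qed.

Lemma ae_leb01 (f g : R -> R) : ae_eq leb I01 f g <-> ae_eq (@leb01 R) setT f g.
Proof.
split=> -[N [mN N0 H]].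
  exists (N `|` ~` I01); split.
  - exact/measurableU/measurableC.
  - change (leb ((N `|` ~` I01) `&` I01) = 0%E).
    rewrite setIUl setICl setU0.
    by apply: subset_measure0 N0 => //; exact: measurableI.
  - move=> x /= fg; have [xI|xI] := pselect (I01 x); last by right.
    by left; apply: H => /= xfg; apply: fg => _; exact: xfg.
exists (N `&` I01); split=> //; first exact: measurableI.
move=> x /= fg; split; last by apply: contrapT => xI; apply: fg.
by apply: H => /= xfg; apply: fg => _; exact: xfg.
Qed.

End unit_measure.

Section covariance_kernel.
Context dO (Omega : measurableType dO) (R : realType) (P : probability Omega R).
Variables (I : Type) (D : set I) (X : I -> Omega -> R).
Hypothesis X0 : zero_mean_field P D X.

Lemma cov_mul t s : D t -> D s -> cov P X t s = \int[P]_w (X t w * X s w).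
Proof.
move=> Dt Ds; have [Xt EXt] := X0 Dt; have [Xs EXs] := X0 Ds.
rewrite /cov unlock EXt EXs unlock; congr fine; apply: eq_integral => w _.
by rewrite -[LHS]/(((X t w - 0) * (X s w - 0))%:E) !subr0.
Qed.

(** The matrix is the Gram matrix of the random variables X (r i). *)
Lemma cov_psd n (r : 'I_n -> I) (c : 'I_n -> R) : (forall i, D (r i)) ->
  0 <= \sum_i \sum_j c i * c j * cov P X (r i) (r j).
Proof.
move=> Dr.
pose x i : L2 P := Lfun_Sub (lee12 R) (X0 (Dr i)).1.
rewrite [leRHS](_ : _ = ip2 (\sum_i c i *: x i) (\sum_i c i *: x i)).
  exact: (ip_ge0 ip2P).
rewrite (ip_suml ip2P); apply: eq_bigr => i _.
rewrite (ip_sumr ip2P); apply: eq_bigr => j _.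
by rewrite (ipZl ip2P) (ipZr ip2P) cov_mul// mulrA.
Qed.

Lemma cov_sym t s : cov P X t s = cov P X s t.
Proof. by rewrite /cov covarianceC. Qed.

End covariance_kernel.

Section interval_spectrum.
Context dO (Omega : measurableType dO) (R : realType) (P : probability Omega R).
Local Notation I01 := (`[0, 1]%classic : set R).
Variables (X : R -> Omega -> R) (lam : nat -> R) (psi : nat -> R -> R).
Hypotheses (X0 : zero_mean_field P I01 X) (Xc : continuous_covariance P X).
Hypothesis X_eigen : eigensystem (cov P X) lam psi.
Local Notation mu := [the probability _ _ of @leb01 R].

Definition covk : measurableTypeR R -> measurableTypeR R -> R := clamped (cov P X).

Lemma covk_psd n (r : 'I_n -> measurableTypeR R) (c : 'I_n -> R) :
  0 <= \sum_i \sum_j c i * c j * covk (r i) (r j).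
Proof. by apply: (cov_psd X0) => i; exact: clamp01. Qed.

Lemma covk_sym t s : covk t s = covk s t.
Proof. exact: cov_sym. Qed.

Lemma covk_step (e : R) : 0 < e ->
  exists n (idx : measurableTypeR R -> 'I_n) (r : 'I_n -> measurableTypeR R),
    (forall i, measurable (idx @^-1` [set i])) /\
    forall t s, `|covk t s - covk (r (idx t)) (r (idx s))| <= e.
Proof. exact: clamped_step. Qed.

Lemma covk_measurable : measurable_fun setT
  (fun p : measurableTypeR R * measurableTypeR R => covk p.1 p.2).
Proof. exact: step_kernel_measurable covk_step. Qed.

Lemma covk_bounded : exists M : R, forall t s, `|covk t s| <= M.
Proof. exact: step_kernel_bounded covk_step. Qed.

Lemma psi_L2 k : psi k \in Lfun mu 2%:E. Proof. exact: eigen_L2 X_eigen k. Qed.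

Definition psi2 k : L2 mu := Lfun_Sub (lee12 R) (psi_L2 k).

Lemma integral_operator_covk (f : L2 mu) t : I01 t ->
  integral_operator (cov P X) f t = kernel_fun covk f t.
Proof.
move=> tI; rewrite /integral_operator /kernel_fun -Rintegral_leb01; last first.
  apply: measurable_funM => //; exact: (measurable_section covk_measurable).
apply: eq_Rintegral => s; rewrite inE => sI.
by rewrite /covk /clamped !clamp_id.
Qed.

Lemma eigen_covk k :
  ae_eq mu setT (kernel_fun covk (psi2 k)) (fun t => lam k * psi k t).
Proof.
apply/ae_leb01; apply: filterS (eigen_eq X_eigen k) => t H tI.
by rewrite -(integral_operator_covk (psi2 k) tI) H.
Qed.

Lemma psi2_orthonormal k l : lam k != 0 -> lam l != 0 ->
  ip2 (psi2 k) (psi2 l) = (k == l)%:R.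
Proof.
move=> k0 l0; rewrite -(eigen_orthonormal X_eigen k0 l0) /ip2 /inner Rintegral_leb01//.
exact: (measurable_funM (measurable_funPT (psi2 k)) (measurable_funPT (psi2 l))).
Qed.

(** The first N eigenvectors being removed, the eigenvectors that remain have
    eigenvalues at most lam N, because the list is exhaustive and sorted. The
    trace is then at most the sum of the first N eigenvalues, plus the rank of
    a step approximation times lam N; that rank does not depend on N, and
    lam N tends to 0. *)
Lemma trace_le_total : cvgn (series lam) -> \int[mu]_t covk t t <= Defs.total lam.
Proof.
move=> cl; have [M KM] := covk_bounded.
pose K : L2 mu -> L2 mu := kernel_op covk_measurable KM covk_step.
have psdK : psd_operator (@ip2 _ _ _ mu) K.
  exact: (kernel_op_psd mu covk_measurable KM covk_sym covk_psd covk_step).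
have H N f : ip2 (K f) f <= \sum_(i < N | lam i != 0) lam i * ip2 f (psi2 i) ^+ 2
    + lam N * ip2 f f.
  apply: (deflated_form_le ip2P psdK _ _ _ _ (eigen_ge0 X_eigen N)).
  - exact: kernel_op_finite_rank.
  - exact: kernel_op_completing.
  - by move=> i j i0 j0; rewrite psi2_orthonormal.
  - move=> i i0 g; rewrite -(ipZl ip2P); apply: ip2_ae.
    exact: eigen_covk.
  move=> rho g rho0 g0 Kg ge.
  rewrite leNgt; apply/negP => Nrho.
  have [n [c gE]] : exists n (c : nat -> R), ae_eq lebesgue_measure I01 g
      (fun t => \sum_(k < n | lam k == rho) c k * psi k t).
    apply: (eigen_exhaustive X_eigen (a := rho)) => //.
    - by rewrite gt_eqF.
    - exact: LfunP.
    - have /ae_leb01 := nrm0_ae Kg.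
      apply: filterS => t H tI; rewrite integral_operator_covk//.
      by apply/eqP; rewrite -subr_eq0; apply/eqP; exact: H.
  pose g' : L2 mu := \sum_(k < n | lam k == rho) c k *: psi2 k.
  have gg : ip2 g g = 0.
    have -> : ip2 g g = ip2 g' g.
      apply: ip2_ae; apply/ae_leb01; apply: filterS gE => t H tI.
      by rewrite H// L2_sumE; apply: eq_bigr.
    rewrite (ip_suml ip2P) big1// => k /eqP kr.
    have kN : (k < N)%N.
      rewrite ltnNge; apply/negP => Nk; move: Nrho.
      by rewrite -kr ltNge (eigen_noninc X_eigen).
    rewrite (ipZl ip2P) (ipC ip2P) (ge (Ordinal kN)) ?mulr0//=.
    by rewrite kr gt_eqF.
  by move: g0; rewrite /nrm gg sqrtr0 ltxx.
apply/ler_addgt0Pr => e e0.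
have e2 : 0 < e / 2 by rewrite divr_gt0.
have [n [idx [r [mi near]]]] := covk_step e2.
have T N : \int[mu]_t covk t t <= Defs.total lam + n%:R * lam N + e.
  have := trace_le_spectrum (mu := mu) (k_meas := covk_measurable) (k_bnd := KM)
    (k_step := covk_step) mi near.
  move=> /(_ _ (fun i : 'I_N => lam i != 0) (fun i => psi2 i) (fun i => lam i) (lam N)).
  have -> : 2 * (e / 2) = e by field.
  move=> /(_ (fun i => eigen_ge0 X_eigen i) _ (eigen_ge0 X_eigen N) (H N)) => HT.
  apply: le_trans (HT _) _; first by move=> i i0; rewrite psi2_orthonormal// eqxx.
  rewrite !lerD2r; apply: le_trans (_ : series lam N <= _).
    rewrite /series /= big_mkord [leRHS](bigID (fun i : 'I_N => lam i != 0))/=.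
    by rewrite lerDl sumr_ge0// => i _; exact: eigen_ge0 X_eigen _.
  apply: nondecreasing_cvgn_le => //; apply/nondecreasing_seqP => j.
  by rewrite /series /= big_nat_recr//= lerDl; exact: eigen_ge0 X_eigen j.
have l0 : n%:R * lam N @[N --> \oo] --> 0.
  rewrite -(mulr0 n%:R); apply: cvgMl_tmp; exact: cvg_series_cvg_0.
have l1 : Defs.total lam + n%:R * lam N + e @[N --> \oo] --> Defs.total lam + e.
  rewrite -[X in _ --> X + e]addr0; apply: cvgD; last exact: cvg_cst.
  by apply: cvgD => //; exact: cvg_cst.
rewrite -(cvg_lim _ l1)//; apply: limr_ge; first exact: cvgP l1.
by apply: nearW => N; exact: T.
Qed.

End interval_spectrum.

(** * Orthogonal projections of bounded corank *)

Section projection.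
Variable R : realFieldType.

(** If v is in the kernel of B B^T then v B is a vector of norm 0. *)
Lemma gram_unit r L (B : 'M[R]_(r, L)) : row_free B -> B *m B^T \in unitmx.
Proof.
move=> Bfree; rewrite -row_free_unit -kermx_eq0; apply/rowV0P => v /sub_kermxP vG.
have vB : v *m B = 0.
  have : (v *m B) *m (v *m B)^T = 0 by rewrite trmx_mul mulmxA -(mulmxA v) vG mul0mx.
  move/matrixP/(_ 0 0); rewrite !mxE => H.
  have nn i : 0 <= (v *m B) 0 i * (v *m B)^T i 0.
    by rewrite [X in _ * X]mxE -expr2 sqr_ge0.
  have {}H := psumr_eq0P (fun i _ => nn i) H.
  apply/rowP => j; rewrite [RHS]mxE.
  have /eqP := H j isT.
  by rewrite [X in _ * X]mxE mulf_eq0 orbb => /eqP.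
by apply: (row_free_inj Bfree); rewrite vB mul0mx.
Qed.

(** The orthogonal projection off the span of the n columns of A. *)
Lemma complementary_projection L n (A : 'M[R]_(L, n)) : exists Q : 'M[R]_L,
  [/\ Q^T = Q, Q *m Q = Q, Q *m A = 0 & \tr Q >= L%:R - n%:R].
Proof.
have [r [B [Bfree AB rn]]] : exists r (B : 'M[R]_(r, L)),
    [/\ row_free B, (A^T <= B)%MS & (r <= n)%N].
  exists (\rank A^T), (row_base A^T).
  by rewrite row_base_free eq_row_base mxrank_tr rank_leq_col.
pose G := B *m B^T; have Gu : G \in unitmx by exact: gram_unit.
have GT : G^T = G by rewrite /G trmx_mul trmxK.
pose Pi := B^T *m invmx G *m B.
have PiT : Pi^T = Pi.
  by rewrite /Pi !trmx_mul trmxK trmx_inv GT mulmxA.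
have PiPi : Pi *m Pi = Pi.
  by rewrite /Pi !mulmxA -[_ *m B *m B^T]mulmxA -/G -[_ *m invmx G *m G]mulmxA mulVmx// mulmx1.
have PiA : Pi *m A = A.
  have /submxP[C AC] := AB.
  have -> : A = B^T *m C^T by rewrite -trmx_mul -AC trmxK.
  by rewrite /Pi !mulmxA -[_ *m B *m B^T]mulmxA -/G -[_ *m invmx G *m G]mulmxA mulVmx// mulmx1.
exists (1%:M - Pi); split.
- by rewrite linearB/= trmx1 PiT.
- by rewrite mulmxBl !mulmxBr !mul1mx mulmx1 PiPi subrr subr0.
- by rewrite mulmxBl mul1mx PiA subrr.
- rewrite linearB/= mxtrace1 lerD2l lerN2 /Pi -mulmxA mxtrace_mulC -mulmxA -/G mulVmx// mxtrace1.
  by rewrite ler_nat.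
Qed.

Definition sqnorm L (x : 'cV[R]_L) := \sum_k x k 0 ^+ 2.

Lemma sqnormE L (x : 'cV[R]_L) : sqnorm x = (x^T *m x) 0 0.
Proof. by rewrite mxE; apply: eq_bigr => k _; rewrite mxE expr2. Qed.

Lemma sqnorm_projection L (Q : 'M[R]_L) (x : 'cV[R]_L) : Q^T = Q -> Q *m Q = Q ->
  sqnorm (Q *m x) <= sqnorm x.
Proof.
move=> QT QQ.
have E : sqnorm x - sqnorm (Q *m x) = sqnorm (x - Q *m x).
  have tB : (x - Q *m x)^T = x^T - x^T *m Q by rewrite linearB/= trmx_mul QT.
  have QQx : x^T *m Q *m (Q *m x) = x^T *m (Q *m x).
    by rewrite -mulmxA (mulmxA Q) QQ.
  rewrite !sqnormE tB trmx_mul QT QQx mulmxBl !mulmxBr QQx -(mulmxA _ Q) subrr subr0.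
  by rewrite [RHS]mxE [X in _ = _ + X]mxE.
by rewrite -subr_ge0 E; apply: sumr_ge0 => k _; exact: sqr_ge0.
Qed.

(** A diagonal entry of Q = Q^T Q is the squared norm of a column. *)
Lemma projection_diag L (Q : 'M[R]_L) l : Q^T = Q -> Q *m Q = Q ->
  \sum_k Q k l ^+ 2 = Q l l.
Proof.
move=> QT QQ; rewrite -{2}QQ mxE; apply: eq_bigr => k _.
by rewrite expr2 -{1}QT mxE.
Qed.

Lemma projection_diag01 L (Q : 'M[R]_L) l : Q^T = Q -> Q *m Q = Q ->
  0 <= Q l l <= 1.
Proof.
move=> QT QQ; have H := projection_diag l QT QQ.
have Q0 : 0 <= Q l l by rewrite -H sumr_ge0// => k _; exact: sqr_ge0.
rewrite Q0/=.
have : Q l l ^+ 2 <= Q l l.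
  by rewrite -{2}H (bigD1 l)//= lerDl sumr_ge0// => k _; exact: sqr_ge0.
by rewrite expr2; nra.
Qed.

End projection.

(** The weights lose the sum of the (1 - p j) m j. Here m j is at most c plus its
    excess over c; the total of the 1 - p j is at most n, and each is at most 1. *)
Lemma threshold_sum (R : realFieldType) (J : finType) (A : pred J) (m p : J -> R) (c : R) n :
  0 <= c -> (forall j, A j -> 0 <= p j <= 1) -> #|A|%:R - n%:R <= \sum_(j | A j) p j ->
  \sum_(j | A j) m j - \sum_(j | A j) Num.max 0 (m j - c) - c * n%:R
    <= \sum_(j | A j) m j * p j.
Proof.
move=> c0 p01 np.
have H j : A j -> m j - Num.max 0 (m j - c) - c + c * p j <= m j * p j.
  move=> Aj; have /andP[p0 p1] := p01 j Aj.
  have : 0 <= Num.max 0 (m j - c) by rewrite le_max lexx.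
  have : m j - c <= Num.max 0 (m j - c) by rewrite le_max lexx orbT.
  set x := Num.max _ _; nra.
apply: le_trans (ler_sum _ H).
rewrite big_split/= -mulr_sumr !sumrB sumr_const -mulr_natr.
have : c * (#|A|%:R - n%:R) <= c * \sum_(j | A j) p j by rewrite ler_wpM2l.
lra.
Qed.

(** * Random elements of a space of square integrable functions *)

Section random_element.
Context d (T : measurableType d) dO (Omega : measurableType dO) (R : realType).
Variables (mu : probability T R) (P : probability Omega R).
Variable Z : T * Omega -> R.
Hypothesis mZ : measurable_fun setT Z.
Hypothesis Z_section : forall t, (fun w => Z (t, w)) \in Lfun P 2%:E.
Hypothesis Z_sqr : (mu \x P)%E.-integrable setT (EFin \o (fun p => Z p ^+ 2)).

Definition in_L2 w := (fun t => Z (t, w)) \in Lfun mu 2%:E.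

Lemma measurable_path w : measurable_fun setT (fun t => Z (t, w)).
Proof. exact: measurable_fun_pair1. Qed.

Lemma ae_in_L2 : {ae P, forall w, in_L2 w}.
Proof.
apply: filterS (ae_integrable2 Z_sqr) => w /integrableP[_ H].
apply: Lfun2P; first exact: measurable_path.
apply: le_lt_trans H; rewrite le_eqVlt; apply/orP; left; apply/eqP.
by apply: eq_integral => t _; rewrite /= ger0_norm ?sqr_ge0.
Qed.

(** Young's inequality: |z f v| <= z^2 + (f v)^2. *)
Lemma integrable_test (f : L2 mu) (v : L2 P) : (mu \x P)%E.-integrable setT
  (EFin \o (fun p => Z p * (f p.1 * v p.2))).
Proof.
have mfv : measurable_fun setT (fun p : T * Omega => f p.1 * v p.2).
  apply: measurable_funM.
  - exact: (measurableT_comp (measurable_funPT f) measurable_fst).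
  - exact: (measurableT_comp (measurable_funPT v) measurable_snd).
have ifv : (mu \x P)%E.-integrable setT
    (EFin \o (fun p => (f p.1 * f p.1) * (v p.2 * v p.2))).
  exact: (integrable_tensor (integrable_mul f f) (integrable_mul v v)).
apply: (le_integrable _ _ _ (integrableD measurableT Z_sqr ifv)) => //.
  exact/measurable_EFinP/measurable_funM.
move=> p _; rewrite /= lee_fin.
set x := Z p; set y := f p.1; set z := v p.2.
have -> : x ^+ 2 + y * y * (z * z) = x ^+ 2 + (y * z) ^+ 2 by ring.
rewrite [leRHS]ger0_norm ?addr_ge0 ?sqr_ge0//.
have H1 := sqr_ge0 (x + y * z); have H2 := sqr_ge0 (x - y * z).
by rewrite ler_norml; apply/andP; split; nra.
Qed.

Definition pairing (f : L2 mu) w := \int[mu]_t (Z (t, w) * f t).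

Lemma integrable_pairing (f : L2 mu) : (mu \x P)%E.-integrable setT
  (EFin \o (fun p => Z p * f p.1)).
Proof.
have := integrable_test f (one2 P).
by apply: eq_integrable => // p _ /=; rewrite mulr1.
Qed.

Lemma measurable_pairing f : measurable_fun setT (pairing f).
Proof. exact: (measurable_Rintegral2 (integrable_pairing f)). Qed.

Definition sample w (H : in_L2 w) : L2 mu := Lfun_Sub (lee12 R) H.

Lemma pairingE f w (H : in_L2 w) : pairing f w = ip2 (sample H) f.
Proof. by []. Qed.

Lemma integrable_sqr_norm : P.-integrable setT (EFin \o (fun w => \int[mu]_t (Z (t, w) ^+ 2))).
Proof. exact: (integrable_Rintegral2 Z_sqr). Qed.

Lemma pairing_L2 f : pairing f \in Lfun P 2%:E.
Proof.
apply: Lfun2P; first exact: measurable_pairing.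
apply: (@le_lt_trans _ _ (\int[P]_w ((\int[mu]_t (Z (t, w) ^+ 2)) * ip2 f f)%:E)%E).
  apply: ae_ge0_le_integral => //.
  - by move=> w _; rewrite lee_fin sqr_ge0.
  - exact/measurable_EFinP/measurable_funX/measurable_pairing.
  - move=> w _; rewrite lee_fin mulr_ge0// ?(ip_ge0 ip2P)//.
    by apply: Rintegral_ge0 => t _; exact: sqr_ge0.
  - apply/measurable_EFinP/measurable_funM => //.
    exact/(measurable_Rintegral2 Z_sqr).
  apply: filterS ae_in_L2 => w H _; rewrite lee_fin (pairingE f H).
  by apply: le_trans (ip_CS ip2P _ _) _.
have /integrableP[_] := integrableZr measurableT (ip2 f f) integrable_sqr_norm.
apply: le_lt_trans; rewrite le_eqVlt; apply/orP; left; apply/eqP.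
apply: eq_integral => w _; rewrite gee0_abs//= lee_fin mulr_ge0// ?(ip_ge0 ip2P)//.
by apply: Rintegral_ge0 => t _; exact: sqr_ge0.
Qed.

Definition pairing2 f : L2 P := Lfun_Sub (lee12 R) (pairing_L2 f).

Definition field_cov t s := \int[P]_w (Z (t, w) * Z (s, w)).

(** With v fixed, Fubini is used for Z (t, w) f t v w only, which is integrable
    because Z is square integrable. Taking v to be a value of the field and
    then another pairing gives the covariance of two pairings. *)
Lemma ip_pairing (f : L2 mu) (v : L2 P) :
  ip2 (pairing2 f) v = \int[mu]_t (f t * \int[P]_w (Z (t, w) * v w)).
Proof.
transitivity (\int[P]_w \int[mu]_t (Z (t, w) * (f t * v w))).
  apply: ae_eq_Rintegral.
  - exact: (measurable_funM (measurable_pairing f) (measurable_funPT v)).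
  - exact: (measurable_Rintegral2 (integrable_test f v)).
  apply: filterS ae_in_L2 => w H.
  rewrite -RintegralZr//; last exact: (integrable_mul (sample H) f).
  by apply: eq_Rintegral => t _; ring.
rewrite -(Rfubini (integrable_test f v)); apply: eq_Rintegral => t _.
rewrite -RintegralZl//; last exact: (integrable_mul (Lfun_Sub (lee12 R) (Z_section t)) v).
by apply: eq_Rintegral => w _ /=; ring.
Qed.

Lemma section_pairing (f : L2 mu) t :
  \int[P]_w (Z (t, w) * pairing f w) = \int[mu]_s (field_cov t s * f s).
Proof.
have := ip_pairing f (Lfun_Sub (lee12 R) (Z_section t)).
rewrite (ipC ip2P) => H; apply: etrans (etrans H _) => //.
apply: eq_Rintegral => s _ /=; rewrite mulrC; congr (_ * _).
by apply: eq_Rintegral => w _; rewrite mulrC.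
Qed.

(** The covariance of the coordinates along f and g is (f, K g), where K is the
    covariance operator. So the coordinates along orthogonal eigenfunctions are
    uncorrelated, and their variances are the eigenvalues. *)
Lemma ip_pairing_eigen (f g : L2 mu) l :
  {ae mu, forall t, \int[mu]_s (field_cov t s * g s) = l * g t} ->
  ip2 (pairing2 f) (pairing2 g) = l * ip2 f g.
Proof.
move=> gE; rewrite ip_pairing -RintegralZl//; last exact: integrable_mul.
have icov : measurable_fun setT (fun t => \int[P]_w (Z (t, w) * pairing g w)).
  have := measurable_Rintegral1 (integrable_test (one2 mu) (pairing2 g)).
  by under eq_fun do under eq_Rintegral do rewrite /= mul1r.
apply: ae_eq_Rintegral.
- exact: (measurable_funM (measurable_funPT f) icov).
- apply: measurable_funM => //.
  exact: (measurable_funM (measurable_funPT f) (measurable_funPT g)).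
apply: filterS gE => t gE.
by rewrite section_pairing gE; ring.
Qed.

Lemma mean_sqr_norm : \int[P]_w \int[mu]_t (Z (t, w) ^+ 2) = \int[mu]_t field_cov t t.
Proof.
by rewrite -(Rfubini Z_sqr); apply: eq_Rintegral => t _; apply: eq_Rintegral => w _.
Qed.

End random_element.

(** * Mean square errors of approximation *)

Section approximation.
Context d (T : measurableType d) dO (Omega : measurableType dO) (R : realType).
Variables (mu : probability T R) (P : probability Omega R).
Variable Z : T * Omega -> R.
Hypothesis mZ : measurable_fun setT Z.
Hypothesis Z_section : forall t, (fun w => Z (t, w)) \in Lfun P 2%:E.
Hypothesis Z_sqr : (mu \x P)%E.-integrable setT (EFin \o (fun p => Z p ^+ 2)).

Local Notation pairing := (@pairing _ T _ Omega R mu Z).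
Local Notation pairing2 := (pairing2 mZ Z_sqr).
Local Notation ae_path := (ae_in_L2 mZ Z_sqr).

Definition mean_sqr_error n (psi : 'I_n -> L2 mu) : \bar R :=
  (\int[P]_w \int[mu]_t ((Z (t, w) - \sum_(i < n) pairing (psi i) w * psi i t) ^+ 2)%:E)%E.

Section error.
Variables (n : nat) (psi : 'I_n -> L2 mu).

Let err w := (\int[mu]_t ((Z (t, w) - \sum_(i < n) pairing (psi i) w * psi i t) ^+ 2)%:E)%E.

Lemma measurable_error : measurable_fun setT err.
Proof.
pose F (p : T * Omega) := ((Z p - \sum_(i < n) pairing (psi i) p.2 * psi i p.1) ^+ 2)%:E.
have mF : measurable_fun setT F.
  apply/measurable_EFinP/measurable_funX/measurable_funB => //.
  apply: measurable_sum => i; apply: measurable_funM.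
  - exact: (measurableT_comp (measurable_pairing mZ Z_sqr (psi i)) measurable_snd).
  - exact: (measurableT_comp (measurable_funPT (psi i)) measurable_fst).
apply: (measurable_fun_fubini_tonelli_G F) => // p.
by rewrite lee_fin sqr_ge0.
Qed.

Definition remainder w (H : in_L2 mu Z w) : L2 mu :=
  sample H - \sum_(i < n) pairing (psi i) w *: psi i.

Lemma errorE w (H : in_L2 mu Z w) : err w = (ip2 (remainder H) (remainder H))%:E.
Proof.
rewrite /ip2 /inner fineK; last first.
  exact: (integrable_fin_num measurableT (integrable_mul (remainder H) (remainder H))).
apply: eq_integral => t _; congr (_%:E).
have -> : remainder H t = Z (t, w) - (\sum_(i < n) pairing (psi i) w *: psi i) t by [].
by rewrite L2_sumE expr2.
Qed.

End error.

Section lower.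
Variables (J : finType) (A : pred J) (phi : J -> L2 mu) (m : J -> R).
Hypothesis phiO : forall i j, A i -> A j -> ip2 (phi i) (phi j) = (i == j)%:R.
Hypothesis phi_eigen : forall j, A j ->
  {ae mu, forall t, \int[mu]_s (field_cov P Z t s * phi j s) = m j * phi j t}.

(** Let Q be the orthogonal projection off the coordinate vectors of the psi i
    in the orthonormal family phi. Whatever multiples of the psi i are
    subtracted from a path, the Q part of its coordinates is left unchanged, so
    that the error is at least the mean square of this part. The coordinates
    are uncorrelated with variances m j, so this mean square is the sum of the
    m j weighted by the diagonal of Q, to which [threshold_sum] applies. *)
Lemma error_ge_threshold n (psi : 'I_n -> L2 mu) (c : R) : 0 <= c ->
  ((\sum_(j | A j) m j - \sum_(j | A j) Num.max 0 (m j - c) - c * n%:R)%:E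
   <= mean_sqr_error psi)%E.
Proof.
move=> c0; pose L := #|A|; pose v (k : 'I_L) := phi (enum_val k).
pose l (k : 'I_L) := m (enum_val k).
have vA (k : 'I_L) : A (enum_val k) by have := enum_valP k.
have vO k k' : ip2 (v k) (v k') = (k == k')%:R.
  by rewrite phiO// (inj_eq enum_val_inj).
pose B : 'M[R]_(L, n) := \matrix_(k, i) ip2 (psi i) (v k).
have [Q [QT QQ QB trQ]] := complementary_projection B.
pose x w : 'cV[R]_L := \col_k pairing (v k) w.
pose b k : L2 P := \sum_i Q k i *: pairing2 (v i).
have bE k w : b k w = (Q *m x w) k 0.
  by rewrite /b L2_sumE mxE; apply: eq_bigr => i _; rewrite mxE.
have low w (H : in_L2 mu Z w) :
    sqnorm (Q *m x w) <= ip2 (remainder psi H) (remainder psi H).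
  have -> : Q *m x w = Q *m (x w - B *m \col_i pairing (psi i) w).
    by rewrite mulmxBr mulmxA QB mul0mx subr0.
  apply: le_trans (sqnorm_projection _ QT QQ) _.
  apply: le_trans (bessel (P := predT) ip2P _ (remainder psi H)); last first.
    by move=> i j _ _; exact: vO.
  rewrite le_eqVlt; apply/orP; left; apply/eqP; apply: eq_bigr => k _.
  congr (_ ^+ 2); rewrite /remainder (ipBl ip2P) (ip_suml ip2P) !mxE; congr (_ - _).
  by apply: eq_bigr => i _; rewrite !mxE (ipZl ip2P) mulrC.
have sumE : \sum_k ip2 (b k) (b k) = \sum_k l k * Q k k.
  rewrite (eq_bigr (fun k => \sum_i l i * Q k i ^+ 2)); last first.
    move=> k _; rewrite (ip_suml ip2P); apply: eq_bigr => i _.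
    rewrite (ipZl ip2P) (ip_sumr ip2P) (bigD1 i)//= big1 => [|j ji].
      rewrite addr0 (ipZr ip2P) (ip_pairing_eigen mZ Z_section Z_sqr _ (phi_eigen (vA i))) vO eqxx.
      by rewrite mulr1 /l; ring.
    rewrite (ipZr ip2P) (ip_pairing_eigen mZ Z_section Z_sqr _ (phi_eigen (vA j))) vO.
    by rewrite eq_sym (negbTE ji) !mulr0.
  rewrite exchange_big; apply: eq_bigr => i _ /=.
  by rewrite -mulr_sumr (projection_diag _ QT QQ).
apply: (@le_trans _ _ (\sum_k ip2 (b k) (b k))%:E).
  rewrite lee_fin sumE.
  have -> : \sum_(j | A j) m j = \sum_k l k by rewrite -(big_enum_val m).
  have -> : \sum_(j | A j) Num.max 0 (m j - c) = \sum_k Num.max 0 (l k - c).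
    by rewrite -(big_enum_val (fun j => Num.max 0 (m j - c))).
  apply: (threshold_sum (A := predT) l) => //.
    by move=> k _; exact: projection_diag01.
  by rewrite card_ord.
apply: (@le_trans _ _ (\int[P]_w (sqnorm (Q *m x w))%:E)%E).
  have ib k : P.-integrable setT (fun w => (b k w * b k w)%:E) by exact: integrable_mul.
  rewrite (eq_integral (fun w => \sum_k (b k w * b k w)%:E)%E); last first.
    move=> w _; rewrite /sqnorm -sumEFin.
    by apply: eq_bigr => k _; rewrite bE expr2.
  rewrite integral_sum// -sumEFin le_eqVlt; apply/orP; left; apply/eqP.
  apply: eq_bigr => k _; rewrite fineK//.
  exact: (integrable_fin_num measurableT (ib k)).
apply: ae_ge0_le_integral => //.
- by move=> w _; rewrite lee_fin sumr_ge0// => k _; exact: sqr_ge0.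
- apply/measurable_EFinP; rewrite /sqnorm.
  apply: measurable_sum => k; apply: measurable_funX.
  by under eq_fun do rewrite -bE; exact: measurable_funPT.
- by move=> w _; apply: integral_ge0 => t _; rewrite lee_fin sqr_ge0.
- exact: measurable_error.
by apply: filterS ae_path => w H _; rewrite (errorE psi H) lee_fin.
Qed.

End lower.

(** Pythagoras: the error is the total mean square minus the variances of the
    coordinates along the phi i. *)
Lemma error_eigen n (phi : 'I_n -> L2 mu) (m : 'I_n -> R) :
  (forall i j, ip2 (phi i) (phi j) = (i == j)%:R) ->
  (forall i, {ae mu, forall t, \int[mu]_s (field_cov P Z t s * phi i s) = m i * phi i t}) ->
  mean_sqr_error phi = (\int[mu]_t field_cov P Z t t - \sum_i m i)%:E.
Proof.
move=> phiO phiE.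
pose r w := \int[mu]_t (Z (t, w) ^+ 2) - \sum_i pairing2 (phi i) w * pairing2 (phi i) w.
have mr : measurable_fun setT r.
  apply: measurable_funB; first exact: (measurable_Rintegral2 Z_sqr).
  by apply: measurable_sum => i; apply: measurable_funM.
have isum : P.-integrable setT (EFin \o (fun w => \sum_i pairing2 (phi i) w * pairing2 (phi i) w)).
  rewrite (_ : EFin \o _ = (fun w => \sum_i (pairing2 (phi i) w * pairing2 (phi i) w)%:E)%E).
    by apply: integrable_sum => // i _; exact: integrable_mul.
  by apply/funext => w /=; rewrite sumEFin.
have ir : P.-integrable setT (EFin \o r).
  exact: (integrableB measurableT (integrable_sqr_norm Z_sqr) isum).
rewrite /mean_sqr_error (ae_eq_integral (EFin \o r))//; last 3 first.
- exact: measurable_error.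
- exact/measurable_EFinP.
- apply: filterS ae_path => w H _; rewrite (errorE phi H) /=; congr (_%:E).
  have -> : remainder phi H = residual (@ip2 _ _ _ mu) predT phi (sample H) by [].
  rewrite (ip_residual ip2P) => [|i j _ _]; last exact: phiO.
  by congr (_ - _); apply: eq_Rintegral => t _; rewrite expr2.
rewrite -[LHS]fineK; last exact: (integrable_fin_num measurableT ir).
congr (_%:E); rewrite -[LHS]/(\int[P]_w r w) RintegralB//; last exact: integrable_sqr_norm.
rewrite (mean_sqr_norm Z_sqr)//; congr (_ - _).
rewrite /Rintegral; under eq_integral do rewrite -sumEFin.
rewrite integral_sum//; last by move=> i; exact: integrable_mul.
rewrite (eq_bigr (fun i => (m i)%:E)) ?sumEFin// => i _.
have <- : ip2 (pairing2 (phi i)) (pairing2 (phi i)) = m i.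
  by rewrite (ip_pairing_eigen mZ Z_section Z_sqr _ (phiE i)) phiO eqxx mulr1.
rewrite fineK//.
exact: (integrable_fin_num measurableT (integrable_mul (pairing2 (phi i)) (pairing2 (phi i)))).
Qed.

End approximation.

(** * Coordinates on the cube *)

Section cube_coordinates.
Variables (R : realType) (n : nat).
Local Notation leb := [the probability _ _ of @leb01 R].
Local Notation mu := (leb_cube R n).
Local Notation RR := (measurableTypeR R).
Local Notation I01 := (`[0, 1]%classic : set R).

Definition axis (i : 'I_n) (t : n.-tuple RR) : RR := tnth t i.

Lemma measurable_coord i : measurable_fun setT (axis i).
Proof. exact: measurable_tnth. Qed.

Lemma leb01_setT : leb setT = 1%E. Proof. exact: probability_setT. Qed.

Lemma coord_law i (A : set RR) : measurable A -> mu (axis i @^-1` A) = leb A.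
Proof.
move=> mA; pose B j := if j == i then A else setT.
have mB j : measurable (B j) by rewrite /B; case: ifP.
have := leb_cube_box mB; rewrite (bigD1 i)//= big1 ?mule1 => [|j /negbTE ji]; last first.
  by rewrite /B ji; exact: leb01_setT.
rewrite {2}/B eqxx => <-; congr (leb_cube R n _).
apply/seteqP; split=> t /= H; last by have := H i; rewrite /B eqxx.
by move=> j; rewrite /B; case: eqP => // ->.
Qed.

(** Two distinct coordinates are independent and uniform. *)
Lemma coord_pair_law i j (A B : set RR) : i != j -> measurable A -> measurable B ->
  mu ((fun t => (axis i t, axis j t)) @^-1` (A `*` B)) = (leb A * leb B)%E.
Proof.
move=> ij mA mB; pose C k := if k == i then A else if k == j then B else setT.
have mC k : measurable (C k) by rewrite /C; case: ifP => // _; case: ifP.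
have := leb_cube_box mC.
rewrite (bigD1 i)//= (bigD1 j)//= 1?eq_sym// big1 ?mule1; last first.
  by move=> k /andP[/negbTE ki /negbTE kj]; rewrite /C ki kj; exact: leb01_setT.
rewrite {2}/C eqxx {2}/C eq_sym (negbTE ij) eqxx => <-; congr (leb_cube R n _).
apply/seteqP; split=> t /= H.
  by move=> k; rewrite /C; case: eqP => [->|_]; [exact: H.1|case: eqP => [->|//]; exact: H.2].
split; first by have := H i; rewrite /C eqxx.
by have := H j; rewrite /C eq_sym (negbTE ij) eqxx.
Qed.

Lemma measurable_cube : measurable (@cube R n : set (n.-tuple RR)).
Proof.
rewrite (_ : @cube R n = \bigcap_(i in [set: 'I_n]) (axis i @^-1` I01)).
  apply: fin_bigcap_measurable => // i _; rewrite -[_ @^-1` _]setTI.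
  by apply: measurable_coord => //; exact: measurable_itv.
by apply/seteqP; split => [t At i _|t At i]; [exact: At|exact: (At i)].
Qed.

Lemma leb01_I01 : leb I01 = 1%E.
Proof.
rewrite -leb01_setT.
change (@lebesgue_measure R (I01 `&` I01) = @lebesgue_measure R (setT `&` I01)).
by rewrite setIid setTI.
Qed.

Lemma cube_full : mu (~` @cube R n) = 0%E.
Proof.
rewrite probability_setC; last exact: measurable_cube.
have -> : mu (@cube R n) = 1%E.
  have := leb_cube_box (fun i : 'I_n => measurable_itv `[0 : R, 1]).
  by rewrite big1 => [|i _]; [|exact: leb01_I01].
by rewrite subee.
Qed.

Lemma L2_coord_proof i (f : L2 leb) : (fun t => f (axis i t)) \in Lfun mu 2%:E.
Proof.
apply: Lfun2P.
  exact: (measurableT_comp (measurable_funPT f) (measurable_coord i)).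
rewrite (ge0_integral_law (nu := leb) (measurable_coord i) (@coord_law i)
  (f := fun x => (f x ^+ 2)%:E)).
- have /integrableP[_] := Lfun2_integrable_sqr (LfunP f).
  apply: le_lt_trans; rewrite le_eqVlt; apply/orP; left; apply/eqP.
  by apply: eq_integral => x _; rewrite /= ger0_norm ?sqr_ge0.
- exact/measurable_EFinP/measurable_funX/measurable_funPT.
- by move=> x; rewrite lee_fin sqr_ge0.
Qed.

Definition L2_coord i (f : L2 leb) : L2 mu := Lfun_Sub (lee12 R) (L2_coord_proof i f).

Lemma ip_coord i (f g : L2 leb) : ip2 (L2_coord i f) (L2_coord i g) = ip2 f g.
Proof.
exact: (Rintegral_law (measurable_coord i) (@coord_law i) (integrable_mul f g)).
Qed.

Lemma Rintegral_coord i (f : L2 leb) : \int[mu]_t f (axis i t) = \int[leb]_x f x.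
Proof.
exact: (Rintegral_law (measurable_coord i) (@coord_law i) (L2_integrable f)).
Qed.

(** Fubini, after [coord_pair_law] has moved the integral to the square. *)
Lemma ip_coord_indep i j (f g : L2 leb) : i != j ->
  ip2 (L2_coord i f) (L2_coord j g) = (\int[leb]_x f x) * \int[leb]_x g x.
Proof.
move=> ij.
have ifg := integrable_tensor (L2_integrable f) (L2_integrable g).
have mc : measurable_fun setT (fun t => (axis i t, axis j t)).
  by apply: measurable_fun_pair; exact: measurable_coord.
have law A := product_law mc (fun B C => @coord_pair_law i j B C ij) (A := A).
have := Rintegral_law mc law ifg => /= H.
rewrite /ip2 /inner; apply: etrans H _.
rewrite -Rintegral_prod1// -RintegralZr//; last exact: L2_integrable.
by apply: eq_Rintegral => x _; rewrite /= RintegralZl//; exact: L2_integrable.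
Qed.

End cube_coordinates.

(** * The additive field *)

Section additive.
Context dO (Omega : measurableType dO) (R : realType) (P : probability Omega R).
Local Notation RR := (measurableTypeR R).
Local Notation I01 := (`[0, 1]%classic : set R).
Local Notation leb := [the probability _ _ of @leb01 R].
Variables (X : nat -> R -> Omega -> R) (n : nat) (Y : n.-tuple RR -> Omega -> R).
Variables (lam : nat -> nat -> R) (psi : nat -> nat -> R -> R) (k0 : nat -> nat).
Hypothesis Xc : forall j, continuous_covariance P (X j).
Hypothesis YX : additive_field P X Y.
Hypothesis XE : forall j, eigensystem (cov P (X j)) (lam j) (psi j).
Hypothesis psi1 : forall j, ae_eq lebesgue_measure I01 (psi j (k0 j)) (cst 1).
Local Notation mu := (leb_cube R n).
Local Notation k j := (covk P (X j)).

(** The field off the cube is arbitrary, possibly not measurable there; it is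
    replaced by 0, which changes it on a null set only. *)
Definition extended : (n.-tuple RR) * Omega -> R :=
  (fun tw => Y tw.1 tw.2) \_ (@cube R n `*` [set: Omega]).
Local Notation Z := extended.

Lemma extended_in t w : cube t -> Z (t, w) = Y t w.
Proof. by move=> ct; rewrite /extended patchE mem_set. Qed.

Lemma extended_out t w : ~ cube t -> Z (t, w) = 0.
Proof. by move=> ct; rewrite /extended patchE memNset//= => -[]. Qed.

Lemma measurable_extended : measurable_fun setT Z.
Proof.
have mC : measurable (@cube R n `*` [set: Omega]).
  by apply: measurableX; [exact: measurable_cube|exact: measurableT].
have [mY _ _] := YX; exact: ((measurable_restrictT _ mC).1 mY).
Qed.

Lemma extended_section t : (fun w => Z (t, w)) \in Lfun P 2%:E.
Proof.
have [ct|nct] := pselect (@cube R n t).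
  have [_ Y0 _] := YX; have [Yt _] := Y0 t ct.
  by rewrite (_ : (fun w => _) = Y t)//; apply/funext => w; rewrite extended_in.
rewrite (_ : (fun w => _) = cst 0); first exact: Lfun_cst.
by apply/funext => w; rewrite extended_out.
Qed.

Definition additive_kernel (t s : n.-tuple RR) := \sum_(j < n) k j (axis j t) (axis j s).

Lemma field_cov_extended t s : cube t -> cube s -> field_cov P Z t s = additive_kernel t s.
Proof.
move=> ct cs; have [_ Y0 Yc] := YX.
transitivity (cov P Y t s).
  rewrite (cov_mul Y0)//; apply: eq_Rintegral => w _.
  by rewrite !extended_in.
rewrite Yc//; apply: eq_bigr => j _; rewrite /covk /clamped /axis.
by rewrite !clamp_id; [|exact: cs|exact: ct].
Qed.

Lemma k_bounded : exists M : R, forall j x y, (j < n)%N -> `|k j x y| <= M.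
Proof.
have /choice[M HM] := fun j => covk_bounded (@Xc j).
exists (\sum_(j < n) `|M j|) => j x y jn.
rewrite (bigD1 (Ordinal jn))//=; apply: le_trans (HM j x y) _.
by apply: le_trans (ler_norm _) _; rewrite lerDl sumr_ge0.
Qed.

(** The integral over the probability space is the variance, which is bounded
    on the cube because each covariance is. *)
Lemma extended_sqr : (mu \x P)%E.-integrable setT (EFin \o (fun p => Z p ^+ 2)).
Proof.
have [M HM] := k_bounded.
have mZ2 : measurable_fun setT (EFin \o (fun p => Z p ^+ 2)).
  apply/measurable_EFinP; apply: measurable_funX; exact: measurable_extended.
apply/integrable12ltyP => //.
apply: (@le_lt_trans _ _ (\int[mu]_t (cst (n%:R * `|M|)%:E t))%E).
  apply: ge0_le_integral => //.
  - by move=> t _; apply: integral_ge0.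
  - apply: (measurable_fun_fubini_tonelli_F (abse \o (EFin \o (fun p => Z p ^+ 2)))) => //=.
    exact: measurableT_comp.
  move=> t _ /=.
  have E : (\int[P]_w `|(Z (t, w) ^+ 2)%:E| = (field_cov P Z t t)%:E)%E.
    have iZ := integrable_mul (Lfun_Sub (lee12 R) (extended_section t)) (Lfun_Sub (lee12 R) (extended_section t)).
    rewrite /field_cov /Rintegral fineK; last exact: (integrable_fin_num measurableT iZ).
    by apply: eq_integral => w _; rewrite /= ger0_norm ?sqr_ge0// expr2.
  rewrite E lee_fin; have [ct|nct] := pselect (@cube R n t); last first.
    rewrite /field_cov; under eq_Rintegral do rewrite extended_out// mul0r.
    by rewrite Rintegral_cst// mul0r mulr_ge0.
  rewrite field_cov_extended//; apply: le_trans (ler_norm _) _.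
  apply: le_trans (ler_norm_sum _ _ _) _.
  apply: le_trans (_ : \sum_(j < n) `|M| <= _).
    by apply: ler_sum => j _; apply: le_trans (HM _ _ _ (ltn_ord j)) (ler_norm _).
  by rewrite sumr_const card_ord mulr_natl.
rewrite integral_cst// [X in (_ * X)%E](_ : _ = 1%E); first by rewrite mule1 ltry.
exact: (probability_setT mu).
Qed.

Local Notation mZ := measurable_extended.

#[local] Instance ae_filter_cube : Filter (almost_everywhere mu).
Proof. exact: ae_filter_ringOfSetsType. Qed.

Lemma ae_cube : {ae mu, forall t, @cube R n t}.
Proof.
have := ae_full (mu := mu) (@measurable_cube R n) (@cube_full R n) (P := @cube R n).
exact.
Qed.

Definition kbound j : R := sval (cid (covk_bounded (@Xc j))).

Lemma kboundP j x y : `|k j x y| <= kbound j.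
Proof. exact: (svalP (cid (covk_bounded (@Xc j)))). Qed.

Definition ksec j (x : RR) : L2 leb := section2 leb (covk_measurable (@Xc j)) (@kboundP j) x.

Lemma measurable_additive_kernel t : measurable_fun setT (additive_kernel t).
Proof.
apply: measurable_sum => j.
exact: (measurableT_comp (measurable_funPT (ksec j (axis j t))) (measurable_coord j)).
Qed.

Lemma measurable_field_cov t : measurable_fun setT (field_cov P Z t).
Proof.
pose v : L2 P := Lfun_Sub (lee12 R) (extended_section t).
have := measurable_Rintegral1 (integrable_test mZ extended_sqr (one2 mu) v).
rewrite (_ : (fun x => _) = field_cov P Z t)//; apply/funext => s.
by apply: eq_Rintegral => w _ /=; ring.
Qed.

(** Each summand of the kernel is, for fixed t, a function of one coordinate of
    s, namely a section of the kernel of one process. *)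
Lemma field_cov_operator (g : L2 mu) t : cube t ->
  \int[mu]_s (field_cov P Z t s * g s) =
  \sum_(j < n) ip2 (L2_coord j (ksec j (axis j t))) g.
Proof.
move=> ct; transitivity (\int[mu]_s (additive_kernel t s * g s)).
  apply: ae_eq_Rintegral.
  - exact: measurable_funM (measurable_field_cov t) (measurable_funPT g).
  - exact: measurable_funM (measurable_additive_kernel t) (measurable_funPT g).
  by apply: filterS ae_cube => s cs; rewrite field_cov_extended.
rewrite -(ip_suml ip2P); apply: eq_Rintegral => s _.
by rewrite L2_sumE.
Qed.

Lemma ip_section j (f : L2 leb) x : ip2 (ksec j x) f = kernel_fun (k j) f x.
Proof. by []. Qed.

(** The eigenvectors that pad a list of finite rank vanish, and 1 does not. *)
Lemma lam_k0_neq0 j : lam j (k0 j) != 0.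
Proof.
apply/negP => /eqP l0; have /ae_leb01 H0 := eigen_pad (XE j) l0.
have /ae_leb01 H1 := @psi1 j.
have : ip2 (one2 leb) (one2 leb) = ip2 (0 : L2 leb) (one2 leb).
  apply: ip2_ae; move: H0 H1; apply: filterS2 => x H0 H1 xT.
  exact: etrans (esym (H1 xT)) (H0 xT).
rewrite (ip0l ip2P) ip_one2 Rintegral_cst// mul1r.
have -> : fine (leb setT) = 1 by have /(congr1 fine) := probability_setT leb.
by move/eqP; rewrite oner_eq0.
Qed.

Local Notation psi2 j := (psi2 (@XE j)).

Lemma psi2_k0_ae j : ae_eq leb setT (psi2 j (k0 j)) (one2 leb).
Proof. by apply/ae_leb01; exact: (@psi1 j). Qed.

Lemma Rintegral_psi2 j i : lam j i != 0 -> i != k0 j -> \int[leb]_x psi2 j i x = 0.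
Proof.
move=> l0 ik; rewrite -ip_one2 (ipC ip2P) -(ip2_ae _ (psi2_k0_ae j)).
by rewrite psi2_orthonormal ?lam_k0_neq0// eq_sym (negbTE ik).
Qed.

Lemma kernel_psi2 j i : {ae leb, forall x, kernel_fun (k j) (psi2 j i) x = lam j i * psi2 j i x}.
Proof. by apply: filterS (eigen_covk (@Xc j) (XE j) i) => x /(_ Logic.I). Qed.

Lemma ae_all_coord (Q : 'I_n -> RR -> Prop) : (forall j, {ae leb, forall x, Q j x}) ->
  {ae mu, forall t, forall j, Q j (axis j t)}.
Proof.
move=> H; have H' (m : nat) : {ae mu, forall t, forall j : 'I_n, j = m :> nat -> Q j (axis j t)}.
  have [mn|nm] := ltnP m n; last first.
    by apply: nearW => t j jm; move: (ltn_ord j); rewrite jm ltnNge nm.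
  have := ae_law (measurable_coord (Ordinal mn)) (@coord_law R n (Ordinal mn)) (H (Ordinal mn)).
  apply: filterS => t Qt j jm.
  by rewrite (_ : j = Ordinal mn)//; exact/val_inj.
have := ae_foralln H'; apply: filterS => t Qt j; exact: (Qt j j).
Qed.

(** In each coordinate 1 is an eigenfunction, so the summands of
    [field_cov_operator] are the constants lam j (k0 j). *)
Lemma eigen_one : {ae mu, forall t,
  \int[mu]_s (field_cov P Z t s * one2 mu s) = (\sum_(j < n) lam j (k0 j)) * one2 mu t}.
Proof.
have H : {ae mu, forall t, forall j : 'I_n, ip2 (ksec j (axis j t)) (one2 leb) = lam j (k0 j)}.
  apply: (@ae_all_coord (fun j x => ip2 (ksec j x) (one2 leb) = lam j (k0 j))) => j.
  move: (kernel_psi2 j (k0 j)) (psi2_k0_ae j); apply: filterS2 => x Kx psix.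
  rewrite (ipC ip2P) -(ip2_ae _ (psi2_k0_ae j)) (ipC ip2P) ip_section Kx.
  by rewrite psix// mulr1.
move: ae_cube H; apply: filterS2 => t ct H.
rewrite field_cov_operator// mulr1; apply: eq_bigr => j _.
by rewrite -H !ip_one2 -[RHS](Rintegral_coord j).
Qed.

(** The other coordinates are independent of t_j, and an eigenfunction orthogonal
    to 1 has mean 0: only the j-th summand of [field_cov_operator] survives. *)
Lemma eigen_coord (j : 'I_n) i : lam j i != 0 -> i != k0 j -> {ae mu, forall t,
  \int[mu]_s (field_cov P Z t s * L2_coord j (psi2 j i) s) = lam j i * L2_coord j (psi2 j i) t}.
Proof.
move=> l0 ik.
have := ae_law (measurable_coord j) (@coord_law R n j) (kernel_psi2 j i).
move: ae_cube; apply: filterS2 => t ct H.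
rewrite field_cov_operator// (bigD1 j)//= big1 ?addr0 => [|j' jj'].
  by rewrite ip_coord ip_section H.
by rewrite ip_coord_indep// (Rintegral_psi2 l0 ik) mulr0.
Qed.

Definition coord_trace j : R := \int[leb]_x k j x x.

Lemma trace_field : \int[mu]_t field_cov P Z t t = \sum_(j < n) coord_trace j.
Proof.
have mdiag j : measurable_fun setT (fun x : RR => k j x x).
  have mp : measurable_fun setT (fun t : RR => (t, t)) by exact: measurable_fun_pair.
  exact: (measurableT_comp (covk_measurable (@Xc j)) mp).
pose dg j : L2 leb := Lfun_Sub (lee12 R) (bounded_Lfun2 leb (mdiag j) (fun x => @kboundP j x x)).
transitivity (\int[mu]_t (\sum_(j < n) L2_coord j (dg j)) t).
  apply: ae_eq_Rintegral.
  - have := measurable_Rintegral1 extended_sqr.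
    by under eq_fun do under eq_Rintegral do rewrite expr2.
  - exact: measurable_funPT.
  apply: filterS ae_cube => t ct.
  by rewrite field_cov_extended// L2_sumE.
rewrite -ip_one2 (ip_suml ip2P); apply: eq_bigr => j _.
by rewrite ip_one2 (Rintegral_coord j (dg j)).
Qed.

(** The barred eigenvalues of all the coordinates form one family, indexed by the
    pairs of a coordinate and a rank; [bump] skips the constant 1. *)
Definition bar_val (x : 'I_n * nat) : R := remaining (lam x.1) (k0 x.1) x.2.

Definition bar_fun (x : 'I_n * nat) : L2 mu :=
  L2_coord x.1 (psi2 x.1 (bump (k0 x.1) x.2)).

Lemma bar_fun_orthonormal (x y : 'I_n * nat) : bar_val x != 0 -> bar_val y != 0 ->
  ip2 (bar_fun x) (bar_fun y) = (x == y)%:R.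
Proof.
case: x y => [j i] [j' i']; rewrite /bar_val/= => x0 y0; have [jj'|jj'] := eqVneq j j'; last first.
  rewrite ip_coord_indep//= (Rintegral_psi2 x0) ?mul0r; last by rewrite eq_sym neq_bump.
  by rewrite xpair_eqE (negbTE jj').
move: y0; rewrite /bar_fun/= -jj' => y0; rewrite ip_coord psi2_orthonormal//.
by rewrite xpair_eqE eqxx/= (inj_eq (can_inj (bumpK _))).
Qed.

Lemma one_bar_fun (x : 'I_n * nat) : bar_val x != 0 -> ip2 (one2 mu) (bar_fun x) = 0.
Proof.
move=> x0; rewrite (ipC ip2P) ip_one2 (Rintegral_coord x.1 (psi2 _ _)).
by rewrite (Rintegral_psi2 x0)// eq_sym neq_bump.
Qed.

Lemma ip_one_one : ip2 (one2 mu) (one2 mu) = 1.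
Proof.
rewrite ip_one2 Rintegral_cst// mul1r.
by have /(congr1 fine) := probability_setT mu.
Qed.

Lemma eigen_bar_fun (x : 'I_n * nat) : bar_val x != 0 -> {ae mu, forall t,
  \int[mu]_s (field_cov P Z t s * bar_fun x s) = bar_val x * bar_fun x t}.
Proof. by move=> x0; apply: eigen_coord => //; rewrite eq_sym neq_bump. Qed.

Lemma cube_integral (f g : n.-tuple RR -> \bar R) : measurable_fun setT g ->
  (forall t, cube t -> f t = g t) ->
  (\int[mu]_(t in @cube R n) f t = \int[mu]_t g t)%E.
Proof.
move=> mg fg; rewrite -(integral_full (@measurable_cube R n) (@cube_full R n) mg).
by apply: eq_integral => t; rewrite inE => /fg.
Qed.

Lemma measurable_extended_path w : measurable_fun setT (fun t => Z (t, w)).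
Proof. exact: (measurable_path mZ). Qed.

(** The norm of Y is the error of the approximation by 0 terms, so it is covered
    by [error_eigen]. *)
Lemma rms_norm_field : rms_norm P Y = sqrte (\sum_(j < n) coord_trace j)%:E.
Proof.
pose e0 (i : 'I_0) : L2 mu := one2 mu; pose m0 (i : 'I_0) : R := 0.
transitivity (sqrte (mean_sqr_error P Z e0)).
  rewrite /rms_norm /mean_sqr_error; apply: (congr1 (@sqrte R)); apply: eq_integral => w _; apply: cube_integral => [|t ct].
    apply/measurable_EFinP/measurable_funX/measurable_funB.
      exact: measurable_extended_path.
    by apply: measurable_sum => -[].
  by rewrite extended_in// big_ord0 subr0.
rewrite (@error_eigen _ _ _ _ _ mu P Z mZ extended_section extended_sqr 0 e0 m0).
- by rewrite big_ord0 subr0 trace_field.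
- by case.
- by case.
Qed.

Lemma rms_norm_error m (ps : 'I_m -> n.-tuple RR -> R)
    (ps2 : forall i, ps i \in Lfun mu 2%:E) :
  rms_norm P (fun t w => Y t w - rank_approx ps Y t w) =
  sqrte (mean_sqr_error P Z (fun i => Lfun_Sub (lee12 R) (ps2 i) : L2 mu)).
Proof.
rewrite /rms_norm /mean_sqr_error; apply: (congr1 (@sqrte R)).
apply: eq_integral => w _.
apply: cube_integral => [|t ct].
  apply/measurable_EFinP/measurable_funX/measurable_funB.
    exact: measurable_extended_path.
  by apply: measurable_sum => i; apply: measurable_funM.
rewrite extended_in//; congr (EFin ((_ - _) ^+ 2)); apply: eq_bigr => i _.
congr (_ * _); rewrite /inner Rintegral_mkcond; apply: eq_Rintegral => s _.
rewrite patchE; case: ifPn => [/set_mem cs|/negP cs]; first by rewrite extended_in.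
by rewrite extended_out ?mul0r// => H; apply: cs; exact: mem_set.
Qed.

Definition bar_val_ord L (x : 'I_n * 'I_L) : R := bar_val (x.1, val x.2).

Lemma approx_error_ge m L (c : R) : 0 <= c ->
  (sqrte (\sum_(x | @bar_val_ord L x != 0) bar_val_ord x - \sum_(x | @bar_val_ord L x != 0) Num.max 0 (bar_val_ord x - c)
     - c * m%:R)%:E
  <= approx_error P Y m)%E.
Proof.
pose v := @bar_val_ord L; move=> c0; apply: le_ereal_inf_tmp => _ [ps ps2 <-].
rewrite (rms_norm_error ps2) lee_sqrt.
  pose ph (x : 'I_n * 'I_L) := bar_fun (x.1, val x.2).
  apply: (@error_ge_threshold _ _ _ _ _ mu P Z mZ extended_section extended_sqr _
    (fun x => v x != 0) ph v) => //.
  - by move=> [j i] [j' i'] /= x0 y0; rewrite bar_fun_orthonormal.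
  - by move=> x x0; exact: eigen_bar_fun.
apply: integral_ge0 => w _; apply: integral_ge0 => t _.
by rewrite lee_fin sqr_ge0.
Qed.

Section optimal.
Variable s : seq ('I_n * nat).
Hypotheses (s_uniq : uniq s) (s_neq0 : {in s, forall x, bar_val x != 0}).

(* Index 0 is for the constant direction, the others follow s. *)
Let best (i : 'I_(size s).+1) : L2 mu :=
  if unlift ord0 i is Some k then bar_fun (tnth (in_tuple s) k) else one2 mu.
Let ev (i : 'I_(size s).+1) : R :=
  if unlift ord0 i is Some k then bar_val (tnth (in_tuple s) k) else \sum_(j < n) lam j (k0 j).

Let best_error : mean_sqr_error P Z best =
  (\sum_(j < n) coord_trace j - \sum_(j < n) lam j (k0 j) - \sum_(x <- s) bar_val x)%:E.
Proof.
have sk k : bar_val (tnth (in_tuple s) k) != 0 by apply: s_neq0; exact: mem_tnth.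
have s_tnth k l : (tnth (in_tuple s) k == tnth (in_tuple s) l) = (k == l).
  by apply: inj_eq; apply/tuple_uniqP.
rewrite (@error_eigen _ _ _ _ _ mu P Z mZ extended_section extended_sqr _ best ev).
- rewrite trace_field big_ord_recl /ev unlift_none opprD addrA (big_tnth _ _ s).
  congr (EFin (_ - _)); apply: eq_bigr => k _.
  by rewrite liftK.
- move=> i j; rewrite /best.
  case: unliftP => [k ->|->]; case: unliftP => [l ->|->].
  + rewrite bar_fun_orthonormal// (inj_eq lift_inj); congr (_%:R); congr nat_of_bool.
    exact: s_tnth.
  + by rewrite (ipC ip2P) one_bar_fun.
  + by rewrite one_bar_fun.
  + by rewrite ip_one_one eqxx.
- move=> i; rewrite /best /ev; case: unliftP => [k _|_]; [exact: eigen_bar_fun|exact: eigen_one].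
Qed.

Lemma approx_error_le : (approx_error P Y (size s).+1 <=
  sqrte (\sum_(j < n) coord_trace j - \sum_(j < n) lam j (k0 j) - \sum_(x <- s) bar_val x)%:E)%E.
Proof.
rewrite -best_error; apply: ereal_inf_lbound.
exists (fun i => best i) => [i|]; first exact: LfunP.
rewrite (rms_norm_error (fun i => LfunP (best i))).
rewrite (_ : (fun i => _) = best)//.
by apply/funext => i; apply/LfuneqP.
Qed.

(** Bessel's inequality for the trace: a mean square error is nonnegative. *)
Lemma optimal_remainder_ge0 :
  0 <= \sum_(j < n) coord_trace j - \sum_(j < n) lam j (k0 j) - \sum_(x <- s) bar_val x.
Proof.
rewrite -lee_fin -best_error; apply: integral_ge0 => w _; apply: integral_ge0 => t _.
by rewrite lee_fin sqr_ge0.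
Qed.

End optimal.

End additive.

(** * Ranked eigenvalues and the quantile function *)

Lemma sum_uniq_le (R : numDomainType) (T : eqType) (s r : seq T) (f : T -> R) :
  uniq s -> uniq r -> (forall x, 0 <= f x) ->
  (forall x, x \in s -> x \notin r -> f x = 0) ->
  \sum_(x <- s) f x <= \sum_(x <- r) f x.
Proof.
move=> us ur f0 fr; rewrite (bigID (mem r))/= [X in _ + X]big_seq_cond.
rewrite [X in _ + X]big1 ?addr0 => [|x /andP[xs xr]]; last exact: fr.
rewrite [leRHS](bigID (mem s))/= -[leLHS]addr0 lerD//; last by apply: sumr_ge0.
rewrite -big_filter -[leRHS]big_filter (perm_big [seq x <- r | x \in s])//.
apply: uniq_perm; rewrite ?filter_uniq// => x.
by rewrite !mem_filter andbC.
Qed.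

Section double_series.
Variables (R : realType) (n : nat) (f : 'I_n -> nat -> R).
Hypothesis f_ge0 : forall j i, 0 <= f j i.

Let grid L : seq ('I_n * nat) := [seq (j, i) | j <- enum 'I_n, i <- iota 0 L].

Lemma mem_grid L (x : 'I_n * nat) : (x \in grid L) = (x.2 < L)%N.
Proof.
apply/allpairsP/idP => [[[j i] /= [_ + ->]]|xL]; first by rewrite mem_iota add0n.
by exists (x.1, x.2); rewrite mem_enum mem_iota add0n xL /=; case: x xL.
Qed.

Lemma uniq_grid L : uniq (grid L).
Proof. by apply: allpairs_uniq; rewrite ?enum_uniq ?iota_uniq// => -[? ?] [? ?]. Qed.

Lemma sum_grid L : \sum_(x <- grid L) f x.1 x.2 = \sum_(j < n) series (f j) L.
Proof.
rewrite big_allpairs_dep /= big_enum; apply: eq_bigr => j _.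
by rewrite /series /= /index_iota subn0.
Qed.

Hypothesis f_cvg : forall j, cvgn (series (f j)).

Lemma cvg_grid : \sum_(j < n) series (f j) L @[L --> \oo] --> \sum_(j < n) Defs.total (f j).
Proof.
by apply: cvg_sumR => j; exact: f_cvg.
Qed.

Lemma nondecreasing_grid : nondecreasing_seq (fun L => \sum_(j < n) series (f j) L).
Proof.
apply/nondecreasing_seqP => L; apply: ler_sum => j _.
by rewrite /series /= big_nat_recr//= lerDl.
Qed.

Lemma sum_grid_le_total L : \sum_(j < n) series (f j) L <= \sum_(j < n) Defs.total (f j).
Proof.
rewrite -(cvg_lim _ cvg_grid)//; apply: nondecreasing_cvgn_le.
  exact: nondecreasing_grid.
exact: cvgP cvg_grid.
Qed.

Lemma sum_seq_le_total (s : seq ('I_n * nat)) : uniq s ->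
  \sum_(x <- s) f x.1 x.2 <= \sum_(j < n) Defs.total (f j).
Proof.
move=> us; pose L := \max_(x <- s) x.2.+1.
apply: le_trans (sum_grid_le_total L); rewrite -sum_grid.
apply: sum_uniq_le => //; first exact: uniq_grid.
move=> x xs; rewrite mem_grid => /negP; case.
by rewrite /L (big_rem x)//= leq_maxl.
Qed.

Lemma total_le_sum_seq (s : seq ('I_n * nat)) : uniq s ->
  (forall x, x \notin s -> f x.1 x.2 = 0) ->
  \sum_(j < n) Defs.total (f j) <= \sum_(x <- s) f x.1 x.2.
Proof.
move=> us fs; rewrite -(cvg_lim _ cvg_grid)//; apply: limr_le; first exact: cvgP cvg_grid.
apply: nearW => L; rewrite -sum_grid; apply: sum_uniq_le => //; first exact: uniq_grid.
by move=> x _ xs; exact: fs.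
Qed.

End double_series.

Lemma integral_step_fun (R : realType) (g : R -> R) (a v : nat -> R) m :
  a 0%N = 0 -> (forall i, (i < m)%N -> a i <= a i.+1) ->
  (forall y, 0 <= g y) ->
  (forall i y, (i < m)%N -> a i < y <= a i.+1 -> g y = v i) ->
  measurable_fun `]0, a m]%classic g /\
  (\int[lebesgue_measure]_(y in `]0%R, a m]) (g y)%:E =
    (\sum_(i < m) (a i.+1 - a i) * v i)%:E)%E.
Proof.
move=> a0; elim: m => [|m IH] am g0 gv.
  by rewrite a0 set_itvoc0 integral_set0 big_ord0; split => //; exact: measurable_fun_set0.
have [mg gI] : measurable_fun `]0, a m]%classic g /\
  (\int[lebesgue_measure]_(y in `]0%R, a m]) (g y)%:E =
    (\sum_(i < m) (a i.+1 - a i) * v i)%:E)%E.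
  apply: IH => // [i im|i y im]; first by apply: am; rewrite ltnS ltnW.
  by apply: gv; rewrite ltnS ltnW.
have a_ge0 : 0 <= a m.
  have H k : (k <= m)%N -> 0 <= a k.
    elim: k => [|k IHk] km; first by rewrite a0.
    by apply: le_trans (IHk (ltnW km)) (am k _); rewrite ltnS ltnW.
  exact: H.
have mpiece : measurable_fun `]a m, a m.+1]%classic g.
  apply: (eq_measurable_fun (cst (v m))) => [y|]; last exact: measurable_cst.
  by rewrite inE/= in_itv/= => H; rewrite (gv m).
have amm : a m <= a m.+1 by exact: am.
have U : `]0, a m.+1]%classic = `]0, a m]%classic `|` `]a m, a m.+1]%classic :> set R.
  apply/seteqP; split=> y /=; rewrite !in_itv/=.
    by case/andP=> y0 ya; have [ym|ym] := leP y (a m); [left|right]; rewrite ?y0 ?ym.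
  case=> /andP[y1 y2]; first by rewrite y1 (le_trans y2).
  by rewrite y2 andbT (le_lt_trans a_ge0).
have mU : measurable_fun `]0, a m.+1]%classic g.
  by rewrite U; apply/measurable_funU => //; split.
split => //.
rewrite U ge0_integral_setU//=; last 3 first.
- by rewrite -U; exact/measurable_EFinP.
- by move=> y _; rewrite lee_fin.
- apply/disj_setPS => y /= []; rewrite !in_itv/= => /andP[_ y1] /andP[y2 _].
  by move: (le_lt_trans y1 y2); rewrite ltxx.
rewrite gI big_ord_recr/= EFinD; congr (_ + _)%E.
rewrite (eq_integral (cst (v m)%:E)); last first.
  by move=> y; rewrite inE/= in_itv/= => H; rewrite (gv m).
rewrite integral_cst//= lebesgue_measure_itv/= lte_fin.
have := am m (leqnn _); rewrite le_eqVlt => /orP[/eqP <-|->].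
  by rewrite ltxx mule0 subrr mul0r.
by rewrite -EFinB -EFinM mulrC.
Qed.

Section ranking.
Variables (R : realType) (n : nat) (b : nat -> nat -> R).
Hypothesis b_ge0 : forall j i, 0 <= b j i.
Hypothesis b_cvg : forall j, cvgn (series (b j)).
Let bb (x : 'I_n * nat) := b x.1 x.2.
Let S := \sum_(j < n) Defs.total (b j).

(** The entries of s are the largest ones of the double family, all positive, in
    non-increasing order: what exceeds an entry precedes it. *)
Definition ranked (s : seq ('I_n * nat)) := uniq s /\
  forall x0 i, (i < size s)%N -> 0 < bb (nth x0 s i) /\
    (forall x, bb (nth x0 s i) < bb x -> x \in take i s) /\
    (forall x, x \in take i.+1 s -> bb (nth x0 s i) <= bb x).

Lemma ranked_take s m : ranked s -> ranked (take m s).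
Proof.
move=> [us H]; split; first exact: take_uniq.
move=> x0 i; rewrite size_take_min ltn_min => /andP[im ims].
rewrite nth_take// !take_takel//; last exact: ltnW.
exact: H.
Qed.

(** Finitely many entries already exceed y. Those that are at least a small
    threshold c still do, and as the families are summable only finitely many
    entries of the whole array are at least c: these are sorted. *)
Lemma ranked_exhausts y : 0 < y -> y < S -> exists s, ranked s /\ y <= \sum_(x <- s) bb x.
Proof.
move=> y0 yS.
have [L HL] : exists L, y < \sum_(j < n) series (b j) L.
  have := @cvg_grid R n (fun j => b j) b_cvg => /cvgrPdist_lt/(_ (S - y)).
  rewrite subr_gt0 => /(_ yS)[L _ /(_ L (leqnn _))] H; exists L.
  have := ler_norm (S - \sum_(j < n) series (b j) L); rewrite -/S in H; lra.
pose grid L : seq ('I_n * nat) := [seq (j, i) | j <- enum 'I_n, i <- iota 0 L].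
have gridE L' : \sum_(x <- grid L') bb x = \sum_(j < n) series (b j) L'.
  exact: (sum_grid (fun j => b j)).
have gu K : uniq (grid K) by exact: uniq_grid.
have gm K (x : 'I_n * nat) : (x \in grid K) = (x.2 < K)%N by exact: mem_grid.
(* Dropping from the grid the entries less than c loses at most the excess over
   y. *)
pose c := (\sum_(j < n) series (b j) L - y) / (size (grid L)).+1%:R.
have c0 : 0 < c by rewrite divr_gt0// subr_gt0.
(* Beyond rank L' all entries are less than c. *)
have [L' [LL' HL']] : exists L', (L <= L')%N /\ forall (j : 'I_n) i, (L' <= i)%N -> b j i < c.
  have H (j : nat) : exists K, forall i, (K <= i)%N -> b j i < c.
    have /cvgrPdist_lt/(_ _ c0)[K _ HK] := cvg_series_cvg_0 (@b_cvg j).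
    exists K => i Ki; have := HK i Ki; rewrite sub0r normrN; exact: le_lt_trans (ler_norm _).
  have [K HK] := choice H.
  exists (maxn L (\max_(j < n) K j)); split; first exact: leq_maxl.
  move=> j i; rewrite geq_max => /andP[_ Ki]; apply: HK; apply: leq_trans Ki.
  exact: leq_bigmax.
pose r := [seq x <- grid L' | c <= bb x].
pose leb x y := bb y <= bb x.
exists (sort leb r).
have leb_tr : transitive leb by move=> u v w H1 H2; exact: le_trans H2 H1.
have leb_tot : ssrbool.total leb by move=> u v; rewrite /leb le_total.
have mem_r x : (x \in sort leb r) = (c <= bb x).
  rewrite mem_sort mem_filter gm; case: ltnP => Lx; first by rewrite andbT.
  by rewrite andbF; apply/esym/negbTE; rewrite -ltNge; exact: HL'.
have us : uniq (sort leb r) by rewrite sort_uniq filter_uniq.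
split; first split=> // x0 i ism.
  have nthr k : (k < size (sort leb r))%N -> c <= bb (nth x0 (sort leb r) k).
    by move=> km; rewrite -mem_r mem_nth.
  have mono k l : (k <= l)%N -> (l < size (sort leb r))%N ->
      bb (nth x0 (sort leb r) l) <= bb (nth x0 (sort leb r) k).
    move=> kl lm; have := @sorted_leq_nth _ leb leb_tr _ x0 _ (sort_sorted leb_tot r).
    by apply => //; [move=> u; exact: lexx|rewrite inE (leq_ltn_trans kl)].
  split; first exact: lt_le_trans (nthr _ ism).
  split=> x Hx.
    have xs : x \in sort leb r.
      by rewrite mem_r; apply: le_trans (ltW Hx); exact: nthr.
    rewrite -(nth_index x0 xs) in Hx *.
    have km : (index x (sort leb r) < size (sort leb r))%N by rewrite index_mem.
    have ki : (index x (sort leb r) < i)%N.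
      by rewrite ltnNge; apply/negP => ik; move: Hx; rewrite ltNge mono.
    by rewrite -(nth_take x0 ki) mem_nth// size_take_min leq_min ki km.
  have := Hx => /(nthP x0)[k]; rewrite size_take_min leq_min => /andP[ki km] <-.
  by rewrite nth_take// mono.
rewrite (perm_big r) ?perm_sort//= big_filter.
have : \sum_(x <- grid L) bb x <= \sum_(x <- grid L | c <= bb x) bb x + c * (size (grid L))%:R.
  rewrite (bigID (fun x => c <= bb x))/= lerD2l.
  apply: le_trans (_ : \sum_(x <- grid L) c <= _); last by rewrite big_const_seq count_predT iter_addr_0 mulr_natr.
  rewrite [leRHS](bigID (fun x => ~~ (c <= bb x)))/= -[leLHS]addr0 lerD//.
    by apply: ler_sum => x; rewrite -ltNge => /ltW.
  by apply: sumr_ge0 => x _; exact: ltW.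
have : \sum_(x <- grid L | c <= bb x) bb x <= \sum_(x <- grid L' | c <= bb x) bb x.
  rewrite -[leLHS]big_filter -[leRHS]big_filter; apply: sum_uniq_le.
  - exact: filter_uniq (gu L).
  - exact: filter_uniq (gu L').
  - by move=> x; exact: b_ge0.
  - move=> x; rewrite !mem_filter !gm => /andP[-> xL].
    by rewrite (leq_trans xL LL').
rewrite gridE.
have : c * (size (grid L)).+1%:R = \sum_(j < n) series (b j) L - y.
  by rewrite /c divfK// pnatr_eq0.
rewrite -natr1 mulrDr mulr1.
lra.
Qed.

(** Cut the list of [ranked_exhausts] at the first rank where it reaches y. *)
Lemma ranked_critical y : 0 < y -> y < S -> exists s, [/\ ranked s, (0 < size s)%N,
  y <= \sum_(x <- s) bb x &
  forall i, (i < size s)%N -> \sum_(x <- take i s) bb x < y].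
Proof.
move=> y0 yS; have [s [rs ys]] := ranked_exhausts y0 yS.
have ex : exists m, y <= \sum_(x <- take m s) bb x by exists (size s); rewrite take_size.
case: (ex_minnP ex) => m ym min_m.
have ms : (m <= size s)%N by apply: min_m; rewrite take_size.
have szm : size (take m s) = m by rewrite size_take_min; apply/minn_idPl.
exists (take m s); split => //; first exact: ranked_take.
  rewrite szm lt0n; apply/eqP => m0; move: ym; rewrite m0 take0 big_nil.
  by rewrite leNgt y0.
move=> i; rewrite szm => im; rewrite take_takel 1?ltnW//.
by rewrite ltNge; apply/negP => /min_m; rewrite leqNgt im.
Qed.

Section quantile.
Variables (s : seq ('I_n * nat)) (x0 : 'I_n * nat).
Hypotheses (s_ranked : ranked s) (S_gt0 : 0 < S).
Let partial i := \sum_(x <- take i s) bb x.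
Let mu i := bb (nth x0 s i).

Let partialS i : (i < size s)%N -> partial i.+1 = partial i + mu i.
Proof. by move=> im; rewrite /partial (take_nth x0 im) big_rcons. Qed.

Let mu_gt0 i : (i < size s)%N -> 0 < mu i.
Proof. by move=> im; have [] := s_ranked.2 x0 i im. Qed.

Let tail c j k := b j k * (c <= b j k)%R%:R.

Let tail_ge0 c j k : 0 <= tail c j k.
Proof. by rewrite mulr_ge0. Qed.

Let tail_cvg c j : cvgn (series (tail c j)).
Proof.
apply: series_le_cvg (@b_cvg j) => [k|k|k]; [exact: tail_ge0|exact: b_ge0|].
by rewrite /tail; case: (c <= _); rewrite ?mulr1 ?mulr0.
Qed.

(** The entries that are at least exp(-x) include the first i + 1 ones when
    exp(-x) <= mu i, and are among the first i ones otherwise. So F reaches y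
    exactly at x = - ln (mu i). *)
Lemma quantile_ranked i y : (i < size s)%N -> partial i < y * S -> y * S <= partial i.+1 ->
  quantile (spectral_cdf b n) y = - ln (mu i).
Proof.
move=> im yi yi1; have [_ [above below]] := s_ranked.2 x0 i im.
have us := s_ranked.1.
have cdfE x : (y <= spectral_cdf b n x) = (- ln (mu i) <= x).
  rewrite /spectral_cdf ler_pdivlMr// -/S.
  rewrite -[in RHS](opprK x) lerN2 -(ler_expR (- x)) lnK ?posrE ?mu_gt0//.
  rewrite -/(tail _).
  have [le_c|lt_c] := leP (expR (- x)) (mu i).
    apply: le_trans yi1 _.
    apply: le_trans (sum_seq_le_total (f := fun j => tail (expR (- x)) j) _ _ (take_uniq i.+1 us)).
    - rewrite /partial !big_seq; apply: ler_sum => z zs.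
      by rewrite /tail (le_trans le_c (below z zs)) mulr1.
    - by move=> *; exact: tail_ge0.
    - by move=> *; exact: tail_cvg.
  apply/negbTE; rewrite -ltNge; apply: le_lt_trans yi.
  apply: le_trans (total_le_sum_seq (f := fun j => tail (expR (- x)) j) _ _ (take_uniq i us) _) _.
  - by move=> *; exact: tail_ge0.
  - by move=> *; exact: tail_cvg.
  - move=> z zs; rewrite /tail; case: leP => [cz|_]; last by rewrite mulr0.
    by case/negP: zs; apply: above; exact: lt_le_trans lt_c cz.
  by apply: ler_sum => z _; rewrite /tail ler_piMr ?b_ge0// lern1 leq_b1.
rewrite /quantile (_ : [set x | _] = [set x | - ln (mu i) <= x]); last first.
  by apply/seteqP; split=> x /=; rewrite cdfE.
apply/eqP; rewrite eq_le; apply/andP; split.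
  by apply: ge_inf => /=; [exists (- ln (mu i)) => z|].
by apply: lb_le_inf => [|z //]; exists (- ln (mu i)) => /=.
Qed.

(** Up to y the function is 1 / mu i on an interval of length mu i / S for each
    i < m, which contributes 1 after multiplication by S; the last interval is
    cut at y. *)
Lemma integral_quantile y m : size s = m.+1 -> 0 < y ->
  (forall i, (i <= m)%N -> partial i < y * S) -> y * S <= partial m.+1 ->
  S * \int[lebesgue_measure]_(z in `]0, y[) expR (quantile (spectral_cdf b n) z) =
  m%:R + (y * S - partial m) / mu m.
Proof.
move=> sm y0 lo hi.
pose g z := expR (quantile (spectral_cdf b n) z).
(* The breakpoints are clipped at y, which only affects the last one. *)
pose a i := Num.min (partial i / S) y.
have aE i : (i <= m)%N -> a i = partial i / S.
  by move=> im; rewrite /a min_l// ler_pdivrMr// ltW// lo.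
have am : a m.+1 = y by rewrite /a min_r// ler_pdivlMr.
have [||||mg gI] := @integral_step_fun R g a (fun i => (mu i)^-1) m.+1.
- by rewrite aE// /partial take0 big_nil mul0r.
- move=> i im; rewrite aE// le_min !ler_pdivrMr// partialS ?sm//.
  by rewrite divfK ?gt_eqF// lerDl ltW ?mu_gt0 ?sm//= ltW// lo.
- by move=> z; exact: expR_ge0.
- move=> i z im; rewrite aE// le_min => /andP[zi /andP[zi1 zy]].
  rewrite /g (@quantile_ranked i) ?sm//.
  + by rewrite expRN lnK// posrE mu_gt0 ?sm.
  + by rewrite -ltr_pdivrMr.
  + by rewrite -ler_pdivlMr.
have -> : \int[lebesgue_measure]_(z in `]0, y[) expR (quantile (spectral_cdf b n) z) =
    \sum_(i < m.+1) (a i.+1 - a i) * (mu i)^-1.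
  rewrite /Rintegral -[RHS]/(fine (\sum_(i < m.+1) (a i.+1 - a i) * (mu i)^-1)%:E) -gI am.
  rewrite -integral_itv_bndo_bndc//.
  rewrite am in mg; apply/measurable_EFinP; apply: measurable_funS (mg).
    exact: measurable_itv.
  by move=> z /=; rewrite !in_itv/= => /andP[-> /ltW].
rewrite big_ord_recr/= am mulrDr aE//; congr (_ + _); last first.
  have := mu_gt0 (i := m); rewrite sm ltnSn => /(_ isT) mm; field.
  by rewrite !gt_eqF.
rewrite (eq_bigr (fun=> S^-1)) => [|[i im] _ /=].
  by rewrite sumr_const card_ord mulrnAr divff ?gt_eqF.
have im' : (i < m)%N := im.
rewrite !aE ?(ltnW im')// partialS ?sm ?ltnS ?(ltnW im')//.
have := mu_gt0 (i := i); rewrite sm ltnS (ltnW im') => /(_ isT) mm; field.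
by rewrite !gt_eqF.
Qed.

End quantile.
End ranking.

(** * Summation over the coordinates and conclusion *)

Lemma series_remaining (R : realType) (lam : nat -> R) k L : (k <= L)%N ->
  series lam L.+1 = lam k + series (remaining lam k) L.
Proof.
move=> kL; rewrite /series /= !big_mkord.
have kL' : (k < L.+1)%N by [].
by rewrite (bigD1_ord (Ordinal kL')).
Qed.

Lemma total_remaining (R : realType) (lam : nat -> R) k :
  cvgn (series (remaining lam k)) ->
  cvgn (series lam) /\ Defs.total lam = lam k + Defs.total (remaining lam k).
Proof.
move=> cr; have H : series lam L @[L --> \oo] --> lam k + Defs.total (remaining lam k).
  rewrite -cvg_shiftS.
  have H : lam k + series (remaining lam k) L @[L --> \oo] -->
      lam k + Defs.total (remaining lam k).
    by apply: cvgD; [exact: cvg_cst|exact: cr].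
  apply: cvg_trans H; apply: near_eq_cvg; exists k => // L /= kL.
  by rewrite (series_remaining lam kL).
by split; [exact: cvgP H|exact: (cvg_lim _ H)].
Qed.

Section summability.
Context dO (Omega : measurableType dO) (R : realType) (P : probability Omega R).
Variables (X : nat -> R -> Omega -> R) (n : nat).
Variable Y : n.-tuple (measurableTypeR R) -> Omega -> R.
Variables (lam : nat -> nat -> R) (psi : nat -> nat -> R -> R) (k0 : nat -> nat).
Hypothesis X0 : forall j, zero_mean_field P `[0, 1]%classic (X j).
Hypothesis Xc : forall j, continuous_covariance P (X j).
Hypothesis YX : additive_field P X Y.
Hypothesis XE : forall j, eigensystem (cov P (X j)) (lam j) (psi j).
Hypothesis psi1 : forall j, ae_eq lebesgue_measure `[0, 1]%classic (psi j (k0 j)) (cst 1).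
Let blam j := remaining (lam j) (k0 j).

Lemma blam_ge0 j i : 0 <= blam j i.
Proof. exact: eigen_ge0 (XE j) _. Qed.

Let tau0 := \sum_(j < n) coord_trace P X j - \sum_(j < n) lam j (k0 j).

Lemma sum_blam_le L : \sum_(j < n) series (blam j) L <= tau0.
Proof.
rewrite -(sum_grid (fun j => blam j)); set g := [seq _ | _ <- _, _ <- _].
have ug : uniq g by exact: uniq_grid.
pose s := [seq x <- g | bar_val lam k0 x != 0].
have us : uniq s by rewrite filter_uniq.
have s0 : {in s, forall x, bar_val lam k0 x != 0} by move=> x; rewrite mem_filter => /andP[].
have := optimal_remainder_ge0 (@Xc) YX XE psi1 us s0.
rewrite subr_ge0 => /(le_trans _); apply.
rewrite /s big_filter [leLHS](bigID (fun x => bar_val lam k0 x != 0))/=.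
rewrite [X in _ + X]big1 ?addr0// => x /negbNE/eqP; exact.
Qed.

(** Summability of the eigenvalues comes from Bessel's inequality for the field,
    which bounds all the partial sums by its trace. *)
Lemma cvg_blam (j : 'I_n) : cvgn (series (blam j)).
Proof.
apply: nondecreasing_is_cvgn.
  apply/nondecreasing_seqP => L.
  by rewrite /series /= big_nat_recr//= lerDl blam_ge0.
exists tau0 => _ [L _ <-]; apply: le_trans (sum_blam_le L).
rewrite (bigD1 j)//= lerDl sumr_ge0// => i _.
by rewrite /series /= sumr_ge0// => k _; exact: blam_ge0.
Qed.

(** At most: [trace_le_total] in each coordinate. At least: Bessel's inequality
    for the family of the constant and the barred eigenfunctions. *)
Lemma trace_total : \sum_(j < n) coord_trace P X j = \sum_(j < n) Defs.total (lam j).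
Proof.
have H (j : 'I_n) := total_remaining (@cvg_blam j).
apply/eqP; rewrite eq_le; apply/andP; split.
  apply: ler_sum => j _.
  exact: trace_le_total (@X0 j) (@Xc j) (XE j) (H j).1.
rewrite (eq_bigr (fun j : 'I_n => lam j (k0 j) + Defs.total (blam j))); last first.
  by move=> j _; exact: (H j).2.
rewrite big_split/= addrC -lerBrDr.
have cg := @cvg_grid R n (fun j => blam j) (fun j => @cvg_blam j).
rewrite -(cvg_lim _ cg)//; apply: limr_le; first exact: cvgP cg.
by apply: nearW => L; exact: sum_blam_le.
Qed.

End summability.

Lemma ceil_unit_step (R : realType) (m : nat) (t : R) : 0 < t -> t <= 1 ->
  Num.ceil (m%:R + t) = m.+1%:Z.
Proof.
move=> t0 t1; apply: ceil_def.
have -> : m.+1%:Z = m%:Z + 1 by rewrite -PoszD addn1.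
by rewrite addrK intrD -!pmulrn ltrDl t0 lerD2l.
Qed.

Unset Implicit Arguments.

Theorem theorem1 (R : realType) (dO : measure_display)
    (Omega : measurableType dO) (P : probability Omega R)
    (X : nat -> R -> Omega -> R)
    (Y : forall d : nat, d.-tuple (measurableTypeR R) -> Omega -> R)
    (lam : nat -> nat -> R) (psi : nat -> nat -> R -> R) (k0 : nat -> nat)
    (X_zero_mean : forall j, zero_mean_field P `[0, 1]%classic (X j))
    (X_cov : forall j, continuous_covariance P (X j))
    (Y_additive : forall d, (0 < d)%N -> additive_field P X (Y d))
    (X_eigen : forall j, eigensystem (cov P (X j)) (lam j) (psi j))
    (basic_assumption : forall j,
       ae_eq lebesgue_measure `[0, 1]%classic (psi j (k0 j)) (cst 1)) :
  let blam j := remaining (lam j) (k0 j) in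
  forall d, (0 < d)%N -> 0 < eps_crit lam blam d ->
  forall eps : R, 0 < eps -> eps < eps_crit lam blam d ->
  let N := complexity_bound lam blam d eps in
  exists n : nat, is_complexity P (Y d) eps n /\ N <= n%:Z <= N + 1.
Proof.
move=> blam d d0 crit0 eps eps0 eps_lt N.
have Ya := Y_additive d d0.
have b_ge0 j i : 0 <= blam j i by exact: (blam_ge0 k0 X_eigen).
have b_cvg j : cvgn (series (blam j)).
  exact: (@cvg_blam _ _ _ _ _ _ _ _ _ _ X_cov (Y_additive j.+1 isT) X_eigen basic_assumption (@ord_max j)).
pose S := \sum_(j < d) Defs.total (blam j).
pose mu0 := \sum_(j < d) lam j (k0 j).
pose La := \sum_(j < d) Defs.total (lam j).
have LaE : La = mu0 + S.
  rewrite /La /mu0 /S -big_split/=; apply: eq_bigr => j _.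
  by have [_] := total_remaining (b_cvg j).
have trE : \sum_(j < d) coord_trace P X j = La.
  exact: (trace_total X_zero_mean X_cov Ya X_eigen basic_assumption).
have mu0_ge0 : 0 <= mu0 by apply: sumr_ge0 => j _; exact: eigen_ge0 (X_eigen j) _.
have S_ge0 : 0 <= S.
  have := sum_seq_le_total (f := fun j : 'I_d => blam j) (fun j i => b_ge0 j i) (fun j => b_cvg j) (isT : uniq [::]).
  by rewrite big_nil.
have La_ge0 : 0 <= La by rewrite LaE addr_ge0.
have crit2 : eps_crit lam blam d ^+ 2 = S / La.
  by rewrite sqr_sqrtr// divr_ge0.
have SLa : 0 < S / La by rewrite -crit2 exprn_gt0.
have S0 : 0 < S.
  by rewrite lt_neqAle S_ge0 andbT; apply: contraTneq SLa => <-; rewrite mul0r ltxx.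
have La0 : 0 < La by rewrite LaE; exact: ltr_wpDl.
pose q := (eps / eps_crit lam blam d) ^+ 2.
have qE : q * S = eps ^+ 2 * La.
  by rewrite /q expr_div_n crit2; field; rewrite !gt_eqF.
have q0 : 0 < q by rewrite exprn_gt0// divr_gt0.
have q1 : q < 1 by rewrite expr_lt1 ?divr_ge0 ?(ltW eps0) ?(ltW crit0)// ltr_pdivrMr// mul1r.
pose y := 1 - q; have y0 : 0 < y by rewrite subr_gt0.
have yS : y * S < S by rewrite gtr_pMl// /y gtrBl.
have [s [s_ranked s_gt0 hi lo]] := ranked_critical b_ge0 b_cvg (mulr_gt0 y0 S0) yS.
have [m sm] : exists m, size s = m.+1 by exists (size s).-1; rewrite prednK.
(* The critical rank is m + 1: the m largest entries have sum M < y S, and the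
   next one, c, makes the sum reach y S. *)
pose x0 := nth (Ordinal d0, 0%N) s 0.
pose bb (x : 'I_d * nat) := blam x.1 x.2.
pose M := \sum_(x <- take m s) bb x.
pose c := bb (nth x0 s m).
have [c0 [above below]] : 0 < c /\
    (forall x, c < bb x -> x \in take m s) /\ (forall x, x \in take m.+1 s -> c <= bb x).
  by apply: (s_ranked.2 x0 m); rewrite sm.
have Mlo : M < y * S by apply: lo; rewrite sm.
have hiM : y * S <= M + c.
  by move: hi; rewrite -{1}(take_size s) sm (take_nth x0) ?sm// big_rcons.
have NE : N = m.+1%:Z.
  rewrite /N /complexity_bound -/q -/y -/S.
  rewrite (integral_quantile b_ge0 b_cvg x0 s_ranked S0 sm y0).
  - rewrite ceil_unit_step//; first by rewrite divr_gt0// subr_gt0.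
    by rewrite ler_pdivrMr// mul1r lerBlDl.
  - by move=> i im; apply: lo; rewrite sm.
  - by rewrite -sm take_size.
have rmsE : rms_norm P (Y d) = sqrte La%:E.
  by rewrite (rms_norm_field X_cov Ya) trE.
have targetE : (eps%:E * rms_norm P (Y d) = sqrte (q * S)%:E)%E.
  by rewrite rmsE qE /= sqrtrM ?sqr_ge0// sqrtr_sqr (gtr0_norm eps0).
have qS0 : 0 <= q * S by rewrite mulr_ge0 ?ltW.
pose ok k := (0 < k)%N /\ (approx_error P (Y d) k <= eps%:E * rms_norm P (Y d))%E.
(* The constant and the m + 1 largest barred eigenfunctions suffice. *)
have ok_hi : ok m.+2.
  split=> //; rewrite targetE -sm.
  apply: le_trans (approx_error_le X_cov Ya X_eigen basic_assumption s_ranked.1 _) _.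
    move=> x xs; have /(nthP x0)[i im <-] := xs.
    by rewrite gt_eqF//; have [] := s_ranked.2 x0 i im.
  rewrite lee_sqrt ?lee_fin//.
  rewrite trE LaE -/mu0 [mu0 + S]addrC addrK.
  rewrite /y in hi; rewrite lerBlDr; move: hi; rewrite mulrBl mul1r; lra.
(* With threshold c only the first m entries have an excess, whose sum is at most
   M - c m. If k <= m, the error is then at least S - M > q S. *)
have ok_lo k : ok k -> (m < k)%N.
  move=> [k_gt0 okk]; rewrite ltnNge; apply/negP => km.
  have key L : \sum_(j < d) series (blam j) L <= q * S + M.
    have := le_trans (approx_error_ge X_cov Ya X_eigen basic_assumption k L (ltW c0)) okk.
    rewrite targetE lee_sqrt ?lee_fin//.
    pose f (j : 'I_d) i := Num.max 0 (blam j i - c).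
    have f_ge0 j i : 0 <= f j i by rewrite le_max lexx.
    have E1 : \sum_(x : 'I_d * 'I_L | bar_val_ord lam k0 x != 0) bar_val_ord lam k0 x =
        \sum_(j < d) series (blam j) L.
      transitivity (\sum_(x : 'I_d * 'I_L) bar_val_ord lam k0 x).
        rewrite [RHS](bigID (fun x => bar_val_ord lam k0 x != 0))/= [X in _ = _ + X]big1 ?addr0//.
        by move=> x /negbNE/eqP.
      rewrite -(pair_bigA _ (fun (j : 'I_d) (i : 'I_L) => blam j i))/=; apply: eq_bigr => j _.
      by rewrite /series /= big_mkord.
    have E2 : \sum_(x : 'I_d * 'I_L | bar_val_ord lam k0 x != 0) Num.max 0 (bar_val_ord lam k0 x - c) <=
        M - c * m%:R.
      apply: le_trans (_ : \sum_(x : 'I_d * 'I_L) f x.1 x.2 <= _).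
        rewrite [leRHS](bigID (fun x => bar_val_ord lam k0 x != 0))/= lerDl sumr_ge0//.
      rewrite -(pair_bigA _ (fun (j : 'I_d) (i : 'I_L) => f j i))/=.
      rewrite (eq_bigr (fun j => series (f j) L)); last first.
        by move=> j _; rewrite /series /= big_mkord.
      rewrite -sum_grid.
      apply: le_trans (_ : \sum_(x <- take m s) f x.1 x.2 <= _).
        apply: sum_uniq_le => //; [exact: uniq_grid|exact/take_uniq/s_ranked.1|].
        move=> x _ xs; rewrite /f max_l// subr_le0 leNgt; apply/negP => cx.
        by case/negP: xs; apply: above.
      rewrite (_ : c * m%:R = \sum_(x <- take m s) c); last first.
        rewrite big_const_seq count_predT iter_addr_0 size_take_min sm.
        by rewrite (minn_idPl (leqnSn m)) mulr_natr.
      rewrite /M -sumrB !big_seq; apply: ler_sum => x xs.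
      rewrite /f max_r// subr_ge0; apply: below.
      by rewrite (take_nth x0) ?sm// mem_rcons inE xs orbT.
    rewrite E1.
    have : c * k%:R <= c * m%:R by rewrite ler_wpM2l ?(ltW c0)// ler_nat.
    lra.
  have cg := @cvg_grid R d (fun j => blam j) (fun j => b_cvg j).
  have : S <= q * S + M.
    apply: (@le_trans _ _ (limn (fun L => \sum_(j < d) series (blam j) L))).
      by rewrite (cvg_lim _ cg).
    by apply: limr_le; [exact: cvgP cg|apply: nearW => L; exact: key].
  by move: Mlo; rewrite /y mulrBl mul1r; lra.
have ex_ok : exists k, `[< ok k >] by exists m.+2; apply/asboolP.
case: (ex_minnP ex_ok) => n /asboolP okn min_n; exists n; split.
  by split=> // k okk; apply: min_n; apply/asboolP.
have nm : (n <= m.+2)%N by apply: min_n; apply/asboolP.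
have mn := ok_lo n okn.
by rewrite NE lez_nat mn -PoszD addn1 lez_nat nm.
Qed.
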